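(* There exists a continuous function $f:2^{\mathbb{N}}\to\mathbb{S}$ that is computable with finitely many mind changes (and hence low and limit computable), but that is not computable relative to the halting problem.
   Context: $2^{\mathbb{N}}=\{0,1\}^{\mathbb{N}}$ is Cantor space, represented as a subspace of $\mathbb{N}^{\mathbb{N}}$ (each point is a name of itself). $\mathbb{S}=\{0,1\}$ is Sierpiński space, represented by the total map $\delta_{\mathbb{S}}:\mathbb{N}^{\mathbb{N}}\to\mathbb{S}$ with $\delta_{\mathbb{S}}(p)=0:\iff p=000\dots$; its topology has open sets $\emptyset,\{1\},\{0,1\}$. A function $f:2^{\mathbb{N}}\to\mathbb{S}$ is continuous or has one of the computability properties below if it has a realizer with that property, i.e. such an $F:\subseteq\mathbb{N}^{\mathbb{N}}\to\mathbb{N}^{\mathbb{N}}$ with $\delta_{\mathbb{S}}F(p)=f(p)$ for all $p\in2^{\mathbb{N}}$. A partial function $F:\subseteq\mathbb{N}^{\mathbb{N}}\to\mathbb{N}^{\mathbb{N}}$ is computable if there is a Turing machine (infinite input tape, one-way output tape) that on each $p\in\mathrm{dom}(F)$ produces $F(p)$ in the long run; it is limit computable if there is a Turing machine with a two-way output tape (it may revise its output) that on each $p\in\mathrm{dom}(F)$ computes $F(p)$ such that each output position $n$ has, after finitely many steps, the content $F(p)(n)$ and is never changed again; it is computable with finitely many mind changes if moreover for each fixed input $p\in\mathrm{dom}(F)$ the machine revises its output only finitely many times in total (over all positions); it is computable relative to $q\in\mathbb{N}^{\mathbb{N}}$ if there is a computable $G$ with $F(p)=G\langle q,p\rangle$ for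 all $p\in\mathrm{dom}(F)$, where $\langle q,p\rangle(2n):=q(n)$, $\langle q,p\rangle(2n+1):=p(n)$. Nothing is required outside $\mathrm{dom}(F)$. The Turing jump $\mathsf{J}:\mathbb{N}^{\mathbb{N}}\to\mathbb{N}^{\mathbb{N}}$ is given by $\mathsf{J}(p)(i)=1$ if the $i$-th Turing machine halts upon input $p$, and $0$ otherwise; it is injective. The halting problem is $0':=\mathsf{J}(000\dots)$. With $\langle n,k\rangle:=\frac12(n+k)(n+k+1)+k$, $\langle p_0,p_1,\dots\rangle\langle n,k\rangle:=p_n(k)$ and $\lim:\langle p_0,p_1,\dots\rangle\mapsto\lim_{i\to\infty}p_i$, a partial function $F$ on $\mathbb{N}^{\mathbb{N}}$ is low if $F=\mathsf{J}^{-1}\circ\lim\circ\,G$ for some computable $G:\subseteq\mathbb{N}^{\mathbb{N}}\to\mathbb{N}^{\mathbb{N}}$. *)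

(* Defs.v *)
From mathcomp Require Import all_boot all_classical topology cantor.

Set Implicit Arguments.
Unset Strict Implicit.
Unset Printing Implicit Defensive.

Local Open Scope classical_set_scope.
Local Open Scope nat_scope.

Notation baire := (prod_topology (fun _ : nat => nat)).

(* Partial functions on Baire space; the domain is the set where the value is
   not None. *)
Notation pfun := (baire -> option baire).

Definition pcontinuous (F : pfun) : Prop :=
  {within [set p | isSome (F p)], continuous (fun p : baire => odflt p (F p))}.

Definition pairn (n k : nat) : nat := ((n + k) * (n + k).+1)./2 + k.

(* The inverse of pairn: walk along the diagonals (n, k) -> (n - 1, k + 1). *)
Fixpoint unpairn (z : nat) : nat * nat :=
  if z is z'.+1 then
    let: (n, k) := unpairn z' in
    if n is n'.+1 then (n', k.+1) else (k.+1, 0)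
  else (0, 0).

Lemma half_pronicS m : (m.+1 * m.+2)./2 = (m * m.+1)./2 + m.+1.
Proof.
have -> : m.+1 * m.+2 = m * m.+1 + m.+1.*2.
  by rewrite [LHS]mulnC !mulSn addnA addnn addnC.
by rewrite halfD odd_double andbF doubleK.
Qed.

Lemma pairn0S k : pairn k.+1 0 = (pairn 0 k).+1.
Proof. by rewrite /pairn !addn0 !add0n half_pronicS addnS. Qed.

Lemma pairnSS n k : pairn n k.+1 = (pairn n.+1 k).+1.
Proof. by rewrite /pairn addSnnS !addnS. Qed.

Lemma unpairnK z : pairn (unpairn z).1 (unpairn z).2 = z.
Proof.
elim: z => [//|z]; rewrite /=; case: (unpairn z) => [[|n] k] /= <-.
  exact: pairn0S.
exact: pairnSS.
Qed.

Lemma pairnK n k : unpairn (pairn n k) = (n, k).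
Proof.
have [d] := ubnP (n + k); elim: d n k => // d IH n k.
elim: k n => [|k IHk] n.
  rewrite addn0; case: n => [//|n]; rewrite ltnS => led.
  by rewrite pairn0S /= (IH 0).
rewrite pairnSS -addSnnS => /IHk; move: (pairn n.+1 k) => z.
by move=> /= ->.
Qed.

Definition interleave (q p : baire) : baire :=
  fun n => if odd n then p n./2 else q n./2.

(* p_n, where r = <p_0, p_1, ...> *)
Definition component (r : baire) (n : nat) : baire := fun k => r (pairn n k).

(* The tape inscription of p : nat -> nat is the 0-1-sequence
   1^(p 0) 0 1^(p 1) 0 1^(p 2) 0 ... (true for 1, false for 0); its n-th 0 is in
   cell p 0 + ... + p n + n. The map p |-> tape_of p is injective. *)
Definition tape_of (p : baire) (c : nat) : bool :=
  ~~ [exists n : 'I_c.+1, c == (\sum_(i < n.+1) p i) + n].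

Inductive move := Left | Stay | Right.

(* All tapes are infinite to the right only; moving left in cell 0 has no
   effect. *)
Definition shift (m : move) (i : nat) : nat :=
  match m with Left => i.-1 | Stay => i | Right => i.+1 end.

(* A machine has a read-only input tape, a work tape and a write-only output
   tape. Its transition table is a finite list of rules (the first applicable
   one is used), so that only finitely many of the states and work symbols,
   which are natural numbers, occur in it. The initial state is 0, the blank
   work symbol is 0. The parameter A is the type of the actions on the
   output tape. *)
Record rule (A : Type) := Rule {
  cur_state : nat;
  read_input : bool;
  read_work : nat;
  new_state : nat;
  write_work : nat;
  move_input : move;
  move_work : move;
  output_action : A }.

Definition machine (A : Type) := seq (rule A).

Record config := Config {
  state : nat;
  input_head : nat;
  work_head : nat;
  work_tape : nat -> nat }.

Definition init_config : config := Config 0 0 0 (fun=> 0).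

Section Run.
Variables (A : Type) (M : machine A) (p : baire).

Definition applicable (c : config) (r : rule A) : bool :=
  [&& cur_state r == state c,
      read_input r == tape_of p (input_head c) &
      read_work r == work_tape c (work_head c)].

Definition next_rule (c : config) : option (rule A) :=
  ohead [seq r <- M | applicable c r].

Definition step (c : config) : config :=
  if next_rule c is Some r then
    Config (new_state r)
      (shift (move_input r) (input_head c))
      (shift (move_work r) (work_head c))
      (fun i => if i == work_head c then write_work r else work_tape c i)
  else c.

Definition run (t : nat) : config := iter t step init_config.

(* The output action of step t, None if the machine has halted. *)
Definition action (t : nat) : option A :=
  omap (@output_action A) (next_rule (run t)).

Definition halts : Prop := exists t, next_rule (run t) = None.

End Run.

(* One-way output tape: in every step, at most one symbol is appended to the
   output. *)
Definition machine1 := machine (option bool).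

Definition output1 (M : machine1) (p : baire) (t : nat) : seq bool :=
  pmap (fun s => obind id (action M p s)) (iota 0 t).

Definition produces (M : machine1) (p q : baire) : Prop :=
  forall n, exists t, onth (output1 M p t) n = Some (tape_of q n).

(* Two-way output tape: in every step, a symbol may be written into the current
   output cell, and then the output head may move. Blank cells are None. *)
Definition machine2 := machine (option bool * move).

Fixpoint output2 (M : machine2) (p : baire) (t : nat) :
    nat * (nat -> option bool) :=
  if t is t'.+1 then
    let: (h, o) := output2 M p t' in
    match action M p t' with
    | Some (Some b, m) => (shift m h, fun n => if n == h then Some b else o n)
    | Some (None, m) => (shift m h, o)
    | None => (h, o)
    end
  else (0, fun=> None).

Definition output_cell (M : machine2) (p : baire) (t n : nat) : option bool :=
  (output2 M p t).2 n.

Definition limit_produces (M : machine2) (p q : baire) : Prop :=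
  forall n, exists t0, forall t, t0 <= t ->
    output_cell M p t n = Some (tape_of q n).

(* In step t, the content of a nonblank output cell is changed. *)
Definition revises (M : machine2) (p : baire) (t : nat) : Prop :=
  exists n b, output_cell M p t n = Some b /\ output_cell M p t.+1 n <> Some b.

Definition finitely_many_revisions (M : machine2) (p : baire) : Prop :=
  finite_set [set t | revises M p t].

Definition computable (F : pfun) : Prop :=
  exists M : machine1, forall p q, F p = Some q -> produces M p q.

Definition limit_computable (F : pfun) : Prop :=
  exists M : machine2, forall p q, F p = Some q -> limit_produces M p q.

Definition finite_mind_change_computable (F : pfun) : Prop :=
  exists M : machine2, forall p q, F p = Some q ->
    limit_produces M p q /\ finitely_many_revisions M p.

Definition computable_relative_to (h : baire) (F : pfun) : Prop :=
  exists2 G : pfun, computable G &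
    forall p q, F p = Some q -> G (interleave h p) = Some q.

(* The first argument is fuel. *)
Fixpoint seq_of_nat_rec (m z : nat) : seq nat :=
  match m, z with
  | m'.+1, z'.+1 => (unpairn z').1 :: seq_of_nat_rec m' (unpairn z').2
  | _, _ => [::]
  end.

Definition seq_of_nat (z : nat) : seq nat := seq_of_nat_rec z z.

Definition move_of_nat (a : nat) : move :=
  match a with 0 => Left | 1 => Stay | _ => Right end.

Definition output_of_nat (a : nat) : option bool :=
  match a with 0 => None | 1 => Some false | _ => Some true end.

Definition rule_of_nat (z : nat) : rule (option bool) :=
  let a := nth 0 (seq_of_nat z) in
  Rule (a 0) (a 1 != 0) (a 2) (a 3) (a 4)
    (move_of_nat (a 5)) (move_of_nat (a 6)) (output_of_nat (a 7)).

Definition nth_machine (i : nat) : machine1 := map rule_of_nat (seq_of_nat i).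

Definition nat_of_seq (s : seq nat) : nat :=
  foldr (fun a z => (pairn a z).+1) 0 s.

Lemma nat_of_seqK : cancel nat_of_seq seq_of_nat.
Proof.
have H s m : nat_of_seq s <= m -> seq_of_nat_rec m (nat_of_seq s) = s.
  elim: s m => [|a s IH] [|m] //=; rewrite ltnS => lem.
  rewrite pairnK /= IH //; apply: leq_trans lem.
  by rewrite /pairn leq_addl.
by move=> s; exact: H.
Qed.

Lemma nth_machine_surj (M : machine1) : exists i, nth_machine i = M.
Proof.
have rP r : exists z, rule_of_nat z = r.
  case: r => q b w q' w' m m' o.
  exists (nat_of_seq [:: q; nat_of_bool b; w; q'; w';
    (if m is Left then 0 else if m is Stay then 1 else 2);
    (if m' is Left then 0 else if m' is Stay then 1 else 2);
    (if o is Some b then b.+1 else 0)]).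
  rewrite /rule_of_nat nat_of_seqK /=.
  by case: b; case: m; case: m'; case: o => [[]|].
have [s sM] : exists s, map rule_of_nat s = M.
  elim: M => [|r M [s <-]]; first by exists [::].
  by have [z <-] := rP r; exists (z :: s).
by exists (nat_of_seq s); rewrite /nth_machine nat_of_seqK.
Qed.

Definition jump (p : baire) : baire :=
  fun i => nat_of_bool `[< halts (nth_machine i) p >].

Definition halting_problem : baire := jump (fun=> 0).

(* The graph of the partial function lim. *)
Definition is_lim (r q : baire) : Prop := component r @ \oo --> q.

(* F is the composite of G, lim and the inverse of the (injective) jump. *)
Definition low (F : pfun) : Prop :=
  exists2 G : pfun, computable G &
    forall p q, F p = Some q <->
      exists2 r, G p = Some r & is_lim r (jump q).

(* false and true are the points 0 and 1 of Sierpinski space. *)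
Definition sierpinski := bool.

Definition deltaS (p : baire) : sierpinski := ~~ `[< forall n, p n = 0 >].

Definition cantor_name (x : cantor_space) : baire :=
  fun n => nat_of_bool (x n).

Definition realizes (F : pfun) (f : cantor_space -> sierpinski) : Prop :=
  forall x, exists2 q, F (cantor_name x) = Some q & deltaS q = f x.

Definition has_realizer (P : pfun -> Prop) (f : cantor_space -> sierpinski) :
    Prop :=
  exists2 F, realizes F f & P F.

(* Main.v *)
(* Let h be the halting problem and let f map 0^omega to 0, each point
   0^i 1 0^omega to 1, and 0^i 1 0^j 1 ... to 0 if and only if machine i, run on
   <h, 0^i 1 0^omega>, outputs its first 1 in step j. For each i at most one j is
   exceptional, so the preimage of 1 is open and f is continuous. If machine i
   realized f relative to h, it would have to output a 1 on 0^i 1 0^omega, say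
   first in step j; but in the first j steps it cannot distinguish this point from
   0^i 1 0^j 1 0^omega, where the value is 0.

   Replacing h by the set of machines that halt within s steps yields a primitive
   recursive guess at f(x) from a prefix of x of length s, and these guesses
   converge. Writing the current guess into the first output cell is therefore a
   computation with finitely many mind changes, with a name q of f(x) in which
   only the first entry may be nonzero. Since q takes only two values, the jump of
   q is the limit over s of the set of machines e that halt on the current guess
   within s steps, so the same realizer is low.

   Primitive recursive functions are run on Turing machines via loop programs over
   counters, which are stored in unary on parallel tracks of the work tape. *)

From HB Require Import structures.
Require Import Defs.
From mathcomp Require Import all_boot all_classical topology cantor zify.

Set Implicit Arguments.
Unset Strict Implicit.
Unset Printing Implicit Defensive.

Local Open Scope nat_scope.

(** * Machines given by finite transition tables *)

(** The diagonalization needs no recursion theorem: the point 0^i 1 0^omega itself carries the index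
    i, so machine i can be run on the very point that names it. Placing the second 1 at distance j
    ties it to running time: every entry takes at least one tape cell and after t steps the head is
    at cell t at most, so steps 0 to j see neither that 1 nor more than finitely many bits of h. The
    first fact defeats the oracle machine; the second makes the guesses settle, although h is only
    approximated. Two realizers are constructed because continuity into Sierpinski space is weaker
    than continuity into discrete {0,1}: the mind-change realizer writes the value outright, whereas
    a continuous one has to delay the 1 until a prefix forces it. Lowness is an equivalence and not
    an implication; this is where injectivity of the jump enters. Machines are literal rule lists,
    so every algorithm must end up as a table. Closing a class of functions on coded data under the
    usual operations leaves a single compilation to verify. *)

Lemma ohead_filter (T : eqType) (P : pred T) (s : seq T) (x : T) :
  x \in s -> P x -> (forall y, y \in s -> P y -> y = x) ->
  ohead [seq y <- s | P y] = Some x.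
Proof.
move=> xs Px uniqx; case E: [seq y <- s | P y] => [|y s'] /=.
  have : x \in [seq y <- s | P y] by rewrite mem_filter Px.
  by rewrite E.
have : y \in [seq y <- s | P y] by rewrite E mem_head.
by rewrite mem_filter => /andP[Py ys]; rewrite (uniqx y ys Py).
Qed.

Lemma ohead_map (T U : Type) (f : T -> U) (s : seq T) :
  ohead (map f s) = omap f (ohead s).
Proof. by case: s. Qed.

Section Trace.
Variables (A : Type) (silent : pred A) (M : machine A) (p : baire).

Fixpoint trace (t : nat) (c : config) : seq A :=
  if t is t'.+1 then
    (if next_rule M p c is Some r then [:: output_action r] else [::])
      ++ trace t' (step M p c)
  else [::].

Lemma trace_add t1 t2 c :
  trace (t1 + t2) c = trace t1 c ++ trace t2 (iter t1 (step M p) c).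
Proof.
by elim: t1 c => [|t IH] c //=; rewrite IH catA -iterS iterSr.
Qed.

Lemma pmap_actionE t : pmap (action M p) (iota 0 t) = trace t init_config.
Proof.
have H u k : pmap (action M p) (iota u k) = trace k (iter u (step M p) init_config).
  elim: k u => [|k IH] u //=; rewrite IH iterS /action /run.
  by case: (next_rule _ _ _).
exact: H.
Qed.

(** A configuration is paired with the loud output so far. Silent actions are dropped, so the
    bookkeeping steps of a compiled program do not show in its specification. *)
Definition reach (x y : config * seq A) : Prop :=
  exists t, iter t (step M p) x.1 = y.1 /\
    y.2 = x.2 ++ [seq a <- trace t x.1 | ~~ silent a].

Lemma reach_refl x : reach x x.
Proof. by exists 0; rewrite /= cats0. Qed.

Lemma reach_trans y x z : reach x y -> reach y z -> reach x z.
Proof.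
move=> [t1 [E1 F1]] [t2 [E2 F2]]; exists (t1 + t2).
rewrite trace_add filter_cat catA -F1 E1 -F2.
by rewrite addnC iterD E1.
Qed.

End Trace.

Section Table.
Variables (Q : eqType) (S : finType) (q0 : Q) (s0 : S) (qs' : seq Q).
Variables (A : Type) (silent : pred A).
Variable delta : Q -> bool -> S -> Q * S * move * move * A.

(** Codes are positions in these lists; heading them with [q0] and [s0] gives the initial state and
    the blank the code 0 that [init_config] fixes. [s0] recurs in [enum S], but the repeated table
    entries are identical rules. *)
Let qs := q0 :: qs'.
Let ss := s0 :: enum S.

Definition rule_for (k : Q * (bool * S)) : rule A :=
  let: (q', s', mi, mw, a) := delta k.1 k.2.1 k.2.2 in
  Rule (index k.1 qs) k.2.1 (index k.2.2 ss) (index q' qs) (index s' ss) mi mw a.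

Definition table_machine : machine A :=
  map rule_for [seq (q, bs) | q <- qs, bs <- [seq (b, s) | b <- [:: true; false], s <- ss]].

Definition conc (q : Q) (ih wh : nat) (T : nat -> S) : config :=
  Config (index q qs) ih wh (fun m => index (T m) ss).

Lemma mem_symbols s : s \in ss.
Proof. by rewrite inE mem_enum orbT. Qed.

Lemma rule_for_cur k : [/\ cur_state (rule_for k) = index k.1 qs,
  read_input (rule_for k) = k.2.1 & read_work (rule_for k) = index k.2.2 ss].
Proof. by rewrite /rule_for; case: delta => [[[[? ?] ?] ?] ?]. Qed.

Lemma index_inj_in (T : eqType) (s : seq T) (x y : T) :
  x \in s -> index x s = index y s -> x = y.
Proof.
move=> xs E; have ys : y \in s by rewrite -index_mem -E index_mem.
by rewrite -(nth_index x xs) E nth_index.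
Qed.

Lemma next_rule_table p q ih wh T : q \in qs ->
  next_rule table_machine p (conc q ih wh T) =
  Some (rule_for (q, (tape_of p ih, T wh))).
Proof.
move=> qin; rewrite /next_rule /table_machine filter_map.
set k := (q, _).
rewrite ohead_map (@ohead_filter _ _ _ k) //.
- apply/allpairsP; exists k; split=> //.
  apply/allpairsP; exists k.2; split=> //=; last exact: mem_symbols.
  by case: tape_of.
- by rewrite /applicable /=; case: (rule_for_cur k) => -> -> -> /=; rewrite !eqxx.
move=> _ /allpairsP[[q1 [b s]] [/= q1in _ ->]].
rewrite /applicable /=; case: (rule_for_cur (q1, (b, s))) => -> -> -> /=.
case/and3P=> /eqP Eq /eqP -> /eqP Es.
by rewrite (index_inj_in q1in Eq) (index_inj_in (mem_symbols _) Es).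
Qed.

Lemma step_table p q ih wh T q' s' mi mw a : q \in qs ->
  delta q (tape_of p ih) (T wh) = (q', s', mi, mw, a) ->
  step table_machine p (conc q ih wh T) =
    conc q' (shift mi ih) (shift mw wh) (fun m => if m == wh then s' else T m)
  /\ trace table_machine p 1 (conc q ih wh T) = [:: a].
Proof.
move=> qin E; rewrite /step /= next_rule_table // /rule_for /= E /=.
split=> //; congr Config; apply: funext => m; by case: eqP.
Qed.

Lemma reach_step p q ih wh T q' s' mi mw a o : q \in qs ->
  delta q (tape_of p ih) (T wh) = (q', s', mi, mw, a) ->
  reach silent table_machine p (conc q ih wh T, o)
    (conc q' (shift mi ih) (shift mw wh) (fun m => if m == wh then s' else T m),
     if silent a then o else rcons o a).
Proof.
move=> qin /(step_table qin)[E1 E2]; exists 1; split => //.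
by rewrite [RHS]/= in E2 *; rewrite E2 /=; case: silent; rewrite /= ?cats0 ?cats1.
Qed.

Lemma conc_init : conc q0 0 0 (fun=> s0) = init_config.
Proof. by rewrite /conc /= !eqxx. Qed.

End Table.

(** * Counter programs *)

Inductive instr (A : Type) :=
| IInc of nat | IDec of nat | IJz of nat & nat | IJmp of nat | IIn of nat
| IOut of A.
Arguments IInc {A}. Arguments IDec {A}. Arguments IJz {A}.
Arguments IJmp {A}. Arguments IIn {A}.

Definition ireg A (i : instr A) : nat :=
  match i with IInc r | IDec r | IJz r _ => r | _ => 0 end.

(** [Exec] includes the scan to the end of a track, [Return] walks back to cell 0, [Clear] erases
    the last mark of a track after a step left, and [Start] marks cell 0 of the blank tape. *)
Inductive phase := Exec | Return | Clear | Start.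

Definition nat_of_phase (f : phase) : nat :=
  match f with Exec => 0 | Return => 1 | Clear => 2 | Start => 3 end.

Definition phase_of_nat (n : nat) : phase :=
  match n with 0 => Exec | 1 => Return | 2 => Clear | _ => Start end.

Lemma nat_of_phaseK : cancel nat_of_phase phase_of_nat.
Proof. by case. Qed.

HB.instance Definition _ := Equality.copy phase (can_type nat_of_phaseK).

Definition upd (s : nat -> nat) (r v : nat) : nat -> nat :=
  fun r' => if r' == r then v else s r'.

Section Flat.
Variables (A : Type) (silent : pred A) (quiet : A) (code : seq (instr A)).
Hypothesis silent_quiet : silent quiet.

Definition nregs := (\max_(i <- code) ireg i).+1.

(* The registers are stored in unary on parallel tracks of the work tape: r.+1
   belongs to the symbol in cell m if m < s r. Track 0 marks cell 0. *)
Definition symbol := {set 'I_nregs.+1}.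
Definition track (r : nat) : 'I_nregs.+1 := inord r.+1.

Definition tracks (s : nat -> nat) (m : nat) : symbol :=
  [set r : 'I_nregs.+1 | if r == ord0 then m == 0 else m < s r.-1].

Definition flat_delta (q : nat * phase) (b : bool) (w : symbol) :
    (nat * phase) * symbol * move * move * A :=
  let: (pc, f) := q in
  match f, onth code pc with
  | Exec, Some (IInc r) =>
      if track r \in w then ((pc, Exec), w, Stay, Right, quiet)
      else ((pc.+1, Return), track r |: w, Stay, Stay, quiet)
  | Exec, Some (IDec r) =>
      if track r \in w then ((pc, Exec), w, Stay, Right, quiet)
      else if ord0 \in w then ((pc.+1, Exec), w, Stay, Stay, quiet)
      else ((pc, Clear), w, Stay, Left, quiet)
  | Exec, Some (IJz r t) =>
      (((if track r \in w then pc.+1 else t), Exec), w, Stay, Stay, quiet)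
  | Exec, Some (IJmp t) => ((t, Exec), w, Stay, Stay, quiet)
  | Exec, Some (IIn t) =>
      (((if b then t else pc.+1), Exec), w, Right, Stay, quiet)
  | Exec, Some (IOut a) => ((pc.+1, Exec), w, Stay, Stay, a)
  | Return, _ => if ord0 \in w then ((pc, Exec), w, Stay, Stay, quiet)
                 else ((pc, Return), w, Stay, Left, quiet)
  | Clear, Some (IDec r) => ((pc.+1, Return), w :\ track r, Stay, Stay, quiet)
  | Start, _ => ((0, Exec), [set ord0], Stay, Stay, quiet)
  | _, _ => (q, w, Stay, Stay, quiet)
  end.

(** The address [size code] is included, since execution arrives there on falling off the end of the
    code. *)
Definition flat_states : seq (nat * phase) :=
  [seq (pc, f) | pc <- iota 0 (size code).+1, f <- [:: Exec; Return; Clear]].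

Definition flat_machine : machine A :=
  table_machine (0, Start) finset.set0 flat_states flat_delta.

Variable p : baire.

Definition fconf (pc : nat) (f : phase) (s : nat -> nat) (ih wh : nat) : config :=
  conc (0, Start) finset.set0 flat_states (pc, f) ih wh (tracks s).

Notation freach := (reach silent flat_machine p).

Lemma mem_flat_states pc f : pc <= size code -> f != Start ->
  (pc, f) \in (0, Start) :: flat_states.
Proof.
move=> lepc nf; rewrite inE; apply/orP; right.
by apply/allpairsP; exists (pc, f); split; rewrite ?mem_iota //; case: f nf.
Qed.

Lemma onth_size pc (i : instr A) : onth code pc = Some i -> pc < size code.
Proof. by move=> E; rewrite -onthTE E. Qed.

Lemma onth_ireg pc (i : instr A) : onth code pc = Some i -> ireg i < nregs.
Proof.
rewrite /nregs ltnS; elim: code pc => [|j l IH] [|pc] //= E; rewrite big_cons.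
  by case: E => ->; rewrite leq_maxl.
by rewrite leq_max (IH _ E) orbT.
Qed.

Lemma track_neq0 r : r < nregs -> (track r == ord0) = false.
Proof. by move=> lt; rewrite -val_eqE /= inordK. Qed.

Lemma in_tracks r s m : r < nregs -> (track r \in tracks s m) = (m < s r).
Proof. by move=> lt; rewrite inE track_neq0 // inordK. Qed.

Lemma mark_in_tracks s m : (ord0 \in tracks s m) = (m == 0).
Proof. by rewrite inE eqxx. Qed.

Lemma flat_step pc f s s' w ih wh pc' f' mi mw a o :
  pc <= size code -> f != Start ->
  flat_delta (pc, f) (tape_of p ih) (tracks s wh) = ((pc', f'), w, mi, mw, a) ->
  (forall m, (if m == wh then w else tracks s m) = tracks s' m) ->
  freach (fconf pc f s ih wh, o)
    (fconf pc' f' s' (shift mi ih) (shift mw wh), if silent a then o else rcons o a).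
Proof.
move=> lepc nf E /funext Es'; rewrite /fconf -Es'; apply: (reach_step _ _ _ _ E).
exact: mem_flat_states.
Qed.

Lemma same_tracks s wh : forall m, (if m == wh then tracks s wh else tracks s m) = tracks s m.
Proof. by move=> m; case: eqP => [->|]. Qed.

Lemma flat_return pc s ih wh o : pc <= size code ->
  freach (fconf pc Return s ih wh, o) (fconf pc Exec s ih 0, o).
Proof.
move=> lepc; elim: wh => [|wh IH].
  have := @flat_step pc Return s s (tracks s 0) ih 0 pc Exec Stay Stay quiet o lepc isT.
  rewrite silent_quiet; apply; last exact: same_tracks.
  by rewrite /= mark_in_tracks.
apply: reach_trans IH.
have := @flat_step pc Return s s (tracks s wh.+1) ih wh.+1 pc Return Stay Left
  quiet o lepc isT.
rewrite silent_quiet; apply; last exact: same_tracks.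
by rewrite /= mark_in_tracks.
Qed.

Lemma flat_scan pc s ih r o :
  onth code pc = Some (IInc r) \/ onth code pc = Some (IDec r) ->
  freach (fconf pc Exec s ih 0, o) (fconf pc Exec s ih (s r), o).
Proof.
move=> E; have [lepc ltr] : pc <= size code /\ r < nregs.
  by case: E => E; split; [exact: ltnW (onth_size E) | exact: (onth_ireg E)
    | exact: ltnW (onth_size E) | exact: (onth_ireg E)].
have : s r <= s r by [].
(* The target is generalized to every position up to [s r]; the bound keeps the cells that are
   passed inside the track. *)
elim: {1 3}(s r) => [|k IH] lek; first exact: reach_refl.
apply: reach_trans (IH (ltnW lek)) _.
have := @flat_step pc Exec s s (tracks s k) ih k pc Exec Stay Right quiet o lepc isT.
rewrite silent_quiet; apply; last exact: same_tracks.
by case: E => /= ->; rewrite in_tracks // lek.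
Qed.

Lemma flat_inc pc s ih r o : onth code pc = Some (IInc r) ->
  freach (fconf pc Exec s ih 0, o) (fconf pc.+1 Exec (upd s r (s r).+1) ih 0, o).
Proof.
move=> E; have ltpc := onth_size E; have /= ltr := onth_ireg E.
apply: reach_trans (flat_scan s ih o (or_introl E)) _.
apply: reach_trans (flat_return _ ih (s r) o ltpc).
have := @flat_step pc Exec s (upd s r (s r).+1) (track r |: tracks s (s r))
  ih (s r) pc.+1 Return Stay Stay quiet o (ltnW ltpc) isT.
rewrite silent_quiet; apply; first by rewrite /= E in_tracks // ltnn.
move=> m; apply/setP => j; rewrite /upd.
case: (eqVneq m (s r)) => [->|nem]; rewrite !inE; last first.
  case: ifP => // j0; case: eqP => // ->; rewrite ltnS [RHS]leq_eqVlt.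
  by rewrite (negbTE nem).
rewrite -(inj_eq val_inj) /= inordK //.
case: (eqVneq j ord0) => [->|j0] //=.
rewrite -[in LHS](prednK (_ : 0 < j)) ?eqSS; last by rewrite lt0n.
by case: eqP => [->|] /=; rewrite ?ltnSn.
Qed.

(** The scan stops at the first cell outside the track. The mark to erase is one cell to the left,
    unless the scan stopped at the marked cell 0, which means that the register is empty. *)
Lemma flat_dec pc s ih r o : onth code pc = Some (IDec r) ->
  freach (fconf pc Exec s ih 0, o) (fconf pc.+1 Exec (upd s r (s r).-1) ih 0, o).
Proof.
move=> E; have ltpc := onth_size E; have /= ltr := onth_ireg E.
apply: reach_trans (flat_scan s ih o (or_intror E)) _.
case sr: (s r) => [|k].
  have := @flat_step pc Exec s (upd s r 0) (tracks s 0)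
    ih 0 pc.+1 Exec Stay Stay quiet o (ltnW ltpc) isT.
  rewrite silent_quiet; apply.
    by rewrite /= E in_tracks // sr mark_in_tracks.
  have -> : upd s r 0 = s by apply: funext => m; rewrite /upd; case: eqP => // ->.
  exact: same_tracks.
apply: reach_trans (flat_return _ ih k o ltpc).
apply: (reach_trans (y := (fconf pc Clear s ih k, o))).
  have := @flat_step pc Exec s s (tracks s k.+1)
    ih k.+1 pc Clear Stay Left quiet o (ltnW ltpc) isT.
  rewrite silent_quiet; apply; last exact: same_tracks.
  by rewrite /= E in_tracks // sr ltnn mark_in_tracks.
have := @flat_step pc Clear s (upd s r k) (tracks s k :\ track r)
  ih k pc.+1 Return Stay Stay quiet o (ltnW ltpc) isT.
rewrite silent_quiet; apply; first by rewrite /= E.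
move=> m; apply/setP => j; rewrite /upd.
case: (eqVneq m k) => [->|nem]; rewrite !inE; last first.
  case: ifP => // j0; case: eqP => // ->; rewrite sr ltnS [LHS]leq_eqVlt.
  by rewrite (negbTE nem).
rewrite -(inj_eq val_inj) /= inordK //.
case: (eqVneq j ord0) => [->|j0] //=.
rewrite -[in LHS](prednK (_ : 0 < j)) ?eqSS; last by rewrite lt0n.
by case: eqP => [->|] /=; rewrite ?ltnn.
Qed.

Lemma flat_jz pc s ih r t o : onth code pc = Some (IJz r t) ->
  freach (fconf pc Exec s ih 0, o)
    (fconf (if s r == 0 then t else pc.+1) Exec s ih 0, o).
Proof.
move=> E; have ltpc := onth_size E; have /= ltr := onth_ireg E.
have := @flat_step pc Exec s s (tracks s 0) ih 0
  (if s r == 0 then t else pc.+1) Exec Stay Stay quiet o (ltnW ltpc) isT.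
rewrite silent_quiet; apply; last exact: same_tracks.
by rewrite /= E in_tracks // lt0n if_neg.
Qed.

Lemma flat_jmp pc s ih t o : onth code pc = Some (IJmp t) ->
  freach (fconf pc Exec s ih 0, o) (fconf t Exec s ih 0, o).
Proof.
move=> E; have ltpc := onth_size E.
have := @flat_step pc Exec s s (tracks s 0) ih 0
  t Exec Stay Stay quiet o (ltnW ltpc) isT.
rewrite silent_quiet; apply; last exact: same_tracks.
by rewrite /= E.
Qed.

Lemma flat_in pc s ih t o : onth code pc = Some (IIn t) ->
  freach (fconf pc Exec s ih 0, o)
    (fconf (if tape_of p ih then t else pc.+1) Exec s ih.+1 0, o).
Proof.
move=> E; have ltpc := onth_size E.
have := @flat_step pc Exec s s (tracks s 0) ih 0
  (if tape_of p ih then t else pc.+1) Exec Right Stay quiet o (ltnW ltpc) isT.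
rewrite silent_quiet; apply; last exact: same_tracks.
by rewrite /= E.
Qed.

Lemma flat_out pc s ih a o : onth code pc = Some (IOut a) ->
  freach (fconf pc Exec s ih 0, o)
    (fconf pc.+1 Exec s ih 0, if silent a then o else rcons o a).
Proof.
move=> E; have ltpc := onth_size E.
have := @flat_step pc Exec s s (tracks s 0) ih 0
  pc.+1 Exec Stay Stay a o (ltnW ltpc) isT.
apply; last exact: same_tracks.
by rewrite /= E.
Qed.

Lemma flat_init o : freach (init_config, o) (fconf 0 Exec (fun=> 0) 0 0, o).
Proof.
rewrite -(conc_init (0, Start) (finset.set0 : symbol) flat_states).
have -> : fconf 0 Exec (fun=> 0) 0 0 =
    conc (0, Start) (finset.set0 : symbol) flat_states (0, Exec)
    0 0 (fun m => if m == 0 then [set ord0] else finset.set0).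
  congr conc; apply: funext => m; apply/setP => r.
  by rewrite inE; case: (m == 0); rewrite !inE //; case: eqP.
have E : flat_delta (0, Start) (tape_of p 0) (finset.set0 : symbol) =
  ((0, Exec), [set ord0]%SET, Stay, Stay, quiet) by [].
have := reach_step finset.set0 silent (T := fun=> finset.set0) (wh := 0) o
  (mem_head (0, Start) flat_states) E.
by rewrite silent_quiet.
Qed.

End Flat.

(** * Loop programs and their compilation to counter programs *)

Inductive cmd (A : Type) :=
| Skip | Inc of nat | Dec of nat | Seq of cmd A & cmd A
| Rep of nat & cmd A | Under of cmd A | If of nat & cmd A & cmd A
| In of nat | Out of A.
Arguments Skip {A}. Arguments Inc {A}. Arguments Dec {A}. Arguments In {A}.

Notation "c1 ;; c2" := (Seq c1 c2) (at level 60, right associativity).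

Definition scons (x : nat) (s : nat -> nat) : nat -> nat :=
  fun r => if r is r'.+1 then s r' else x.

Section Cmd.
Variables (A : Type) (silent : pred A) (p : baire).

Definition cstate : Type := (nat -> nat) * nat * seq A.

(* Rep r c decrements r before each execution of c; Under c runs c with the
   registers renumbered so that register 0 is out of its reach. *)
Fixpoint exec (c : cmd A) (x : cstate) : cstate :=
  let: (s, ih, o) := x in
  match c with
  | Skip => x
  | Inc r => (upd s r (s r).+1, ih, o)
  | Dec r => (upd s r (s r).-1, ih, o)
  | Seq c1 c2 => exec c2 (exec c1 x)
  | Rep r c1 =>
      iter (s r) (fun y => exec c1 (upd y.1.1 r (y.1.1 r).-1, y.1.2, y.2)) x
  | Under c1 => let: (s', ih', o') := exec c1 (fun r => s r.+1, ih, o) in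
                (scons (s 0) s', ih', o')
  | If r c1 c2 => if s r == 0 then exec c2 x else exec c1 x
  | In r => (if tape_of p ih then upd s r (s r).+1 else s, ih.+1, o)
  | Out a => (s, ih, if silent a then o else rcons o a)
  end.

Fixpoint writes (c : cmd A) (r : nat) : bool :=
  match c with
  | Skip | Out _ => false
  | Inc r' | Dec r' | In r' => r == r'
  | Seq c1 c2 | If _ c1 c2 => writes c1 r || writes c2 r
  | Rep r' c1 => (r == r') || writes c1 r
  | Under c1 => (r != 0) && writes c1 r.-1
  end.

(** [exec] fixes the number of rounds of a [Rep] in advance, whereas the compiled loop tests the
    register in every round; the two agree when the body leaves that register alone. *)
Fixpoint wf (c : cmd A) : bool :=
  match c with
  | Seq c1 c2 | If _ c1 c2 => wf c1 && wf c2
  | Rep r c1 => ~~ writes c1 r && wf c1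
  | Under c1 => wf c1
  | _ => true
  end.

Lemma exec_notin c r x : ~~ writes c r -> (exec c x).1.1 r = x.1.1 r.
Proof.
elim: c r x => [|r'|r'|c1 IH1 c2 IH2|r' c IH|c IH|r' c1 IH1 c2 IH2|r'|a] r
  [[s ih] o] //=; rewrite /upd.
- by move/negbTE ->.
- by move/negbTE ->.
- by rewrite negb_or => /andP[w1 w2]; rewrite IH2 // IH1.
- rewrite negb_or => /andP[nr w].
  by elim: (s r') => // n {}IHn /=; rewrite IH //= (negbTE nr).
- case E: (exec c _) => [[s' ih'] o'] /=; case: r => //= r w.
  by have := IH r (fun r => s r.+1, ih, o) w; rewrite E.
- by rewrite negb_or => /andP[w1 w2]; case: eqP => _; rewrite (IH1, IH2).
- by case: tape_of => //; move/negbTE ->.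
Qed.

(** [b] counts the registers hidden by the enclosing [Under]s, and [pc] is the address of the first
    instruction, required because jumps are absolute. *)
Fixpoint compile (b pc : nat) (c : cmd A) : seq (instr A) :=
  match c with
  | Skip => [::]
  | Inc r => [:: IInc (b + r)]
  | Dec r => [:: IDec (b + r)]
  | Seq c1 c2 => let l := compile b pc c1 in l ++ compile b (pc + size l) c2
  | Rep r c1 =>
      let l := compile b (pc + 2) c1 in
      [:: IJz (b + r) (pc + size l + 3), IDec (b + r) & l ++ [:: IJmp pc]]
  | Under c1 => compile b.+1 pc c1
  | If r c1 c2 =>
      let l1 := compile b pc.+1 c1 in
      let l2 := compile b (pc + size l1 + 2) c2 in
      IJz (b + r) (pc + size l1 + 2) :: l1 ++ IJmp (pc + size l1 + 2 + size l2) :: l2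
  | In r => [:: IIn (pc + 2); IJmp (pc + 3); IInc (b + r)]
  | Out a => [:: IOut a]
  end.

Definition glue (b : nat) (S s : nat -> nat) : nat -> nat :=
  fun r => if r < b then S r else s (r - b).

Lemma glue_upd b S s r v : glue b S (upd s r v) = upd (glue b S s) (b + r) v.
Proof.
apply: funext => k; rewrite /glue /upd; case: ltnP => [ltk|lek].
  by rewrite ltn_eqF // ltn_addr.
by rewrite -(eqn_add2l b) subnKC.
Qed.

Lemma glue_addr b S s r : glue b S s (b + r) = s r.
Proof. by rewrite /glue ltnNge leq_addr /= addKn. Qed.

Lemma glue_scons b S s x : glue b S (scons x s) = glue b.+1 (upd S b x) s.
Proof.
apply: funext => k; rewrite /glue /upd ltnS.
case: ltngtP => //= [ltk|->]; last by rewrite subnn.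
by rewrite -(subnSK ltk).
Qed.

Definition code_at (code : seq (instr A)) (pc : nat) (l : seq (instr A)) : Prop :=
  forall k i, onth l k = Some i -> onth code (pc + k) = Some i.

Lemma code_at_cat code pc l1 l2 : code_at code pc (l1 ++ l2) ->
  code_at code pc l1 /\ code_at code (pc + size l1) l2.
Proof.
move=> H; split=> k i E.
  by apply: H; rewrite onth_cat -onthTE E.
by rewrite -addnA; apply: H; rewrite onth_cat ltnNge leq_addr /= addKn.
Qed.

Lemma code_at_cons code pc i l : code_at code pc (i :: l) ->
  onth code pc = Some i /\ code_at code pc.+1 l.
Proof.
by move=> H; split=> [|k j E]; [rewrite -(addn0 pc)|rewrite addSnnS]; apply: H.
Qed.

Section Correct.
Variables (quiet : A) (code : seq (instr A)).
Hypothesis silent_quiet : silent quiet.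

Definition creach (pc pc' : nat) (x y : cstate) : Prop :=
  reach silent (flat_machine quiet code) p
    (fconf code pc Exec x.1.1 x.1.2 0, x.2)
    (fconf code pc' Exec y.1.1 y.1.2 0, y.2).

Lemma creach_trans pc2 y pc1 pc3 x z :
  creach pc1 pc2 x y -> creach pc2 pc3 y z -> creach pc1 pc3 x z.
Proof. exact: reach_trans. Qed.

Definition gluec (b : nat) (S : nat -> nat) (x : cstate) : cstate :=
  (glue b S x.1.1, x.1.2, x.2).

Lemma compile_correct c b pc S x : wf c ->
  code_at code pc (compile b pc c) ->
  creach pc (pc + size (compile b pc c)) (gluec b S x) (gluec b S (exec c x)).
Proof.
elim: c b pc S x => [|r|r|c1 IH1 c2 IH2|r c IH|c IH|r c1 IH1 c2 IH2|r|a] b pc S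
  [[s ih] o] /=; rewrite /gluec /=.
- by move=> _ _; rewrite addn0; exact: reach_refl.
- move=> _ /code_at_cons[E _]; rewrite addn1 glue_upd -[in (s r).+1](glue_addr b S s r).
  exact: (flat_inc silent_quiet).
- move=> _ /code_at_cons[E _]; rewrite addn1 glue_upd -[in (s r).-1](glue_addr b S s r).
  exact: (flat_dec silent_quiet).
- move=> /andP[w1 w2] /code_at_cat[C1 C2].
  apply: creach_trans (IH1 b pc S (s, ih, o) w1 C1) _.
  by rewrite size_cat addnA; apply: IH2.
- move=> /andP[nw w] /code_at_cons[E1 /code_at_cons[E2]].
  set l := compile _ _ _ => C; have [C1 /code_at_cons[E3 _]] := code_at_cat C.
  have -> : pc + (size (l ++ [:: IJmp pc])).+2 = pc + size l + 3.
    by rewrite size_cat !addnS !addn0.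
  set f := fun y : cstate => _.
  have fr (y : cstate) : (f y).1.1 r = (y.1.1 r).-1.
    by rewrite /f exec_notin //= /upd eqxx.
  (* The loop is treated for an arbitrary state with n rounds left, since the body may change
     everything except register r. *)
  move En : (s r) => n; have : ((s, ih, o) : cstate).1.1 r = n by [].
  rewrite -[X in creach _ _ X]/(gluec b S (s, ih, o)) -/(gluec b S (iter n f (s, ih, o))).
  move: (s, ih, o) => x {En}; elim: n x => [|n IHn] x xr.
    have := flat_jz silent_quiet p (glue b S x.1.1) x.1.2 x.2 E1.
    by rewrite glue_addr xr; apply.
  rewrite iterSr; apply: (creach_trans _ (IHn (f x) _)); last by rewrite fr xr.
  have R1 : creach pc pc.+1 (gluec b S x) (gluec b S x).
    have := flat_jz silent_quiet p (glue b S x.1.1) x.1.2 x.2 E1.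
    by rewrite glue_addr xr.
  have R2 : creach pc.+1 pc.+2 (gluec b S x)
      (gluec b S (upd x.1.1 r (x.1.1 r).-1, x.1.2, x.2)).
    rewrite /gluec /= glue_upd -[in (x.1.1 r).-1](glue_addr b S x.1.1 r).
    exact: (flat_dec silent_quiet).
  apply: (creach_trans R1); apply: (creach_trans R2).
  rewrite -[pc.+2]addn2 in C1 E3 *.
  apply: (creach_trans (IH b (pc + 2) S _ w C1)).
  exact: (flat_jmp silent_quiet _ _ _ _ E3).
(* The register hidden by [Under] joins the protected part: [S] is extended at [b] by [s 0]. *)
- move=> w C; have := IH b.+1 pc (upd S b (s 0)) (fun r => s r.+1, ih, o) w C.
  rewrite /gluec /= -!glue_scons.
  have -> : scons (s 0) (fun r => s r.+1) = s by apply: funext; case.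
  case E: (exec c _) => [[s' ih'] o'] /=.
  by rewrite glue_scons.
- move=> /andP[w1 w2] /code_at_cons[E1].
  set l1 := compile _ _ c1; set l2 := compile _ _ c2.
  rewrite -/l1 in E1; move=> C; have [C1 /code_at_cons[E2 C2]] := code_at_cat C.
  have R : creach pc (if s r == 0 then pc + size l1 + 2 else pc.+1)
      (gluec b S (s, ih, o)) (gluec b S (s, ih, o)).
    have := flat_jz silent_quiet p (glue b S s) ih o E1.
    by rewrite glue_addr.
  apply: (creach_trans R).
  have -> : pc + (size (l1 ++ IJmp (pc + size l1 + 2 + size l2) :: l2)).+1 =
            pc + size l1 + 2 + size l2.
    by rewrite size_cat /= !addnS !addn0 addnA.
  case: eqP => sr.
    by apply: (IH2 b _ S (s, ih, o) w2); move: C2; rewrite addSn -addn2.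
  apply: (creach_trans (IH1 b pc.+1 S (s, ih, o) w1 C1)).
  exact: (flat_jmp silent_quiet _ _ _ _ E2).
- move=> _ /code_at_cons[E1 /code_at_cons[E2 /code_at_cons[E3 _]]].
  have R : creach pc (if tape_of p ih then pc + 2 else pc.+1)
      (glue b S s, ih, o) (glue b S s, ih.+1, o).
    exact: (flat_in silent_quiet).
  apply: (creach_trans R); case: tape_of.
    rewrite addn2 addn3 glue_upd -[in (s r).+1](glue_addr b S s r).
    exact: (flat_inc silent_quiet).
  exact: (flat_jmp silent_quiet).
- move=> _ /code_at_cons[E _]; rewrite addn1.
  exact: (flat_out silent quiet p (glue b S s) ih o E).
Qed.

End Correct.
End Cmd.

(** * Primitive recursive functions *)

Arguments exec : simpl never.

Definition reg (l : seq nat) : nat -> nat := nth 0 l.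

Lemma upd_reg l r v : upd (reg l) r v = reg (set_nth 0 l r v).
Proof. by apply: funext => k; rewrite /upd /reg nth_set_nth. Qed.

Lemma scons_reg x l : scons x (reg l) = reg (x :: l).
Proof. by apply: funext; case. Qed.

Lemma reg_pad n l : reg (l ++ nseq n 0) = reg l.
Proof.
apply: funext => r; rewrite /reg nth_cat nth_nseq; case: ltnP => // le.
by rewrite if_same nth_default.
Qed.

Section ExecReg.
Variables (A : Type) (silent : pred A) (p : baire).
Implicit Types (c : cmd A) (l : seq nat) (ih : nat) (o : seq A).
Notation ex := (exec silent p).

Lemma exec_seq c1 c2 x : ex (c1 ;; c2) x = ex c2 (ex c1 x).
Proof. by case: x => [[]]. Qed.

Lemma exec_skip x : ex Skip x = x.
Proof. by case: x => [[]]. Qed.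

Lemma exec_inc r l ih o :
  ex (Inc r) (reg l, ih, o) = (reg (set_nth 0 l r (nth 0 l r).+1), ih, o).
Proof. by rewrite -upd_reg. Qed.

Lemma exec_dec r l ih o :
  ex (Dec r) (reg l, ih, o) = (reg (set_nth 0 l r (nth 0 l r).-1), ih, o).
Proof. by rewrite -upd_reg. Qed.

Lemma exec_if r c1 c2 l ih o :
  ex (If r c1 c2) (reg l, ih, o) =
  ex (if nth 0 l r == 0 then c2 else c1) (reg l, ih, o).
Proof. by rewrite [LHS]/exec; case: ifP. Qed.

Lemma exec_in r l ih o :
  ex (In r) (reg l, ih, o) =
  (reg (set_nth 0 l r (tape_of p ih + nth 0 l r)), ih.+1, o).
Proof.
rewrite /exec -upd_reg; case: tape_of => //.
by congr (_, _, _); apply: funext => k; rewrite /upd; case: eqP => [->|].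
Qed.

Lemma exec_out a l ih o :
  ~~ silent a -> ex (Out a) (reg l, ih, o) = (reg l, ih, rcons o a).
Proof. by rewrite /exec => /negbTE ->. Qed.

Lemma exec_under x c l ih o l' ih' o' :
  ex c (reg l, ih, o) = (reg l', ih', o') ->
  ex (Under c) (reg (x :: l), ih, o) = (reg (x :: l'), ih', o').
Proof.
move=> E; rewrite -!scons_reg.
have H s : ex (Under c) (s, ih, o) =
  (let: (s', ih', o') := ex c (fun r => s r.+1, ih, o) in (scons (s 0) s', ih', o')).
  by [].
by rewrite H [ex c _]E.
Qed.

Lemma exec_rep0 r c l ih o :
  nth 0 l r = 0 -> ex (Rep r c) (reg l, ih, o) = (reg l, ih, o).
Proof. by rewrite /exec /reg => ->. Qed.

Lemma exec_repS n r c l ih o : ~~ writes c r -> nth 0 l r = n.+1 ->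
  ex (Rep r c) (reg l, ih, o) =
  ex (Rep r c) (ex c (reg (set_nth 0 l r n), ih, o)).
Proof.
have H s ih' o' : ex (Rep r c) (s, ih', o') =
  iter (s r) (fun y => ex c (upd y.1.1 r (y.1.1 r).-1, y.1.2, y.2)) (s, ih', o').
  by [].
move=> nw E; rewrite -upd_reg H [reg l r]E iterSr /= [reg l r]E /=.
case F: (ex c _) => [[s' ih'] o'].
have En : s' r = n.
  by have := exec_notin silent p (upd (reg l) r n, ih, o) nw; rewrite F /= /upd eqxx.
by rewrite H En.
Qed.

Lemma rep_clear r l ih o :
  ex (Rep r Skip) (reg l, ih, o) = (reg (set_nth 0 l r 0), ih, o).
Proof.
have [n E] : {n | nth 0 l r = n} by exists (nth 0 l r).
elim: n l E => [|n IH] l E.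
  rewrite exec_rep0 // -upd_reg; congr (_, _, _).
  by apply: funext => k; rewrite /upd; case: eqP => [->|].
rewrite (exec_repS ih o _ E) // exec_skip IH ?nth_set_nth /= ?eqxx //.
by rewrite set_set_nth eqxx.
Qed.

Lemma rep_move r r' l ih o : r != r' ->
  ex (Rep r (Inc r')) (reg l, ih, o) =
  (reg (set_nth 0 (set_nth 0 l r' (nth 0 l r + nth 0 l r')) r 0), ih, o).
Proof.
move=> ne; have [n E] : {n | nth 0 l r = n} by exists (nth 0 l r).
elim: n l E => [|n IH] l E.
  rewrite exec_rep0 // -!upd_reg E add0n; congr (_, _, _).
  apply: funext => k; rewrite /upd; case: eqP => [->|_] //; by case: eqP => [->|].
rewrite (exec_repS ih o _ E) //= exec_inc IH ?nth_set_nth /= ?nth_set_nth /=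
  ?(negbTE ne) ?eqxx //.
rewrite eq_sym (negbTE ne) E addSnnS -!upd_reg; congr (_, _, _).
by apply: funext => k; rewrite /upd; do 2![case: eqP => // _].
Qed.

End ExecReg.

(** All functions are unary and pairs are numbers, so each program takes its argument and leaves its
    value in register 0. [Iter] offers neither parameters nor the round number; both are recovered
    by carrying them in a pair. *)
Inductive pr :=
| Zero | Succ | Id | Fst | Snd | Comp of pr & pr | Pair of pr & pr | Iter of pr.

Fixpoint ev (c : pr) (x : nat) : nat :=
  match c with
  | Zero => 0
  | Succ => x.+1
  | Id => x
  | Fst => (unpairn x).1
  | Snd => (unpairn x).2
  | Comp f g => ev f (ev g x)
  | Pair f g => pairn (ev f x) (ev g x)
  | Iter f => iter (unpairn x).1 (ev f) (unpairn x).2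
  end.

Section Programs.
Variables (A : Type) (silent : pred A) (p : baire).
Notation cmd := (cmd A).
Notation ex := (exec silent p).

Definition copy_prog : cmd := Rep 0 (Inc 1 ;; Inc 2) ;; Rep 2 (Inc 0).

(** This is the diagonal walk that defines [unpairn], with the current pair in registers 1 and 2 and
    the number of remaining steps in register 0. *)
Definition unpair_prog : cmd :=
  Rep 0 (If 1 (Dec 1 ;; Inc 2) (Rep 2 (Inc 1) ;; Inc 1)) ;;
  Rep 1 (Inc 0) ;; Rep 2 (Inc 1).

(** The summands 1, ..., n + k are added to k, which gives the triangular number in [pairn].
    Register 3 holds the current summand, register 2 its scratch copy. *)
Definition pair_prog : cmd :=
  Rep 2 (Inc 1 ;; Inc 0) ;;
  Rep 1 (Inc 3 ;; Rep 3 (Inc 0 ;; Inc 2) ;; Rep 2 (Inc 3)) ;; Rep 3 Skip.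

(** Calling convention: on entry and on exit all registers except 0 are 0. [Under] gives a nested
    call its own register 0 and protects the values stored below it. *)
Fixpoint prog (c : pr) : cmd :=
  match c with
  | Zero => Rep 0 Skip
  | Succ => Inc 0
  | Id => Skip
  | Fst => unpair_prog ;; Rep 1 Skip
  | Snd => unpair_prog ;; Rep 0 Skip ;; Rep 1 (Inc 0)
  | Comp f g => prog g ;; prog f
  | Pair f g => copy_prog ;; Under (prog f) ;; Rep 0 (Inc 2) ;;
                Under (Under (prog g)) ;; pair_prog
  | Iter f => unpair_prog ;; Rep 0 (Under (prog f)) ;; Rep 1 (Inc 0)
  end.

Lemma wf_prog c : wf (prog c).
Proof. by elim: c => [| | | | |f IHf g IHg|f IHf g IHg|f IHf] //=; rewrite IHf ?IHg. Qed.

Lemma copy_progE x ih o : ex copy_prog (reg [:: x], ih, o) = (reg [:: x; x], ih, o).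
Proof.
rewrite -[reg [:: x]](reg_pad 2) -[reg [:: x; x]](reg_pad 1) /copy_prog exec_seq /=.
have H n a b : ex (Rep 0 (Inc 1 ;; Inc 2)) (reg [:: n; a; b], ih, o) =
    (reg [:: 0; n + a; n + b], ih, o).
  elim: n a b => [|n IH] a b; first by rewrite exec_rep0.
  by rewrite (exec_repS _ _ (n := n)) //= exec_seq !exec_inc /= IH !addnS.
by rewrite H rep_move //= !addn0.
Qed.

Lemma unpair_progE z ih o :
  ex unpair_prog (reg [:: z], ih, o) = (reg [:: (unpairn z).1; (unpairn z).2], ih, o).
Proof.
rewrite -[reg [:: z]](reg_pad 2) -(reg_pad 1 [:: _; _]) /unpair_prog exec_seq /=.
pose next (nk : nat * nat) := if nk.1 is n'.+1 then (n', nk.2.+1) else (nk.2.+1, 0).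
have H m n k : ex (Rep 0 (If 1 (Dec 1 ;; Inc 2) (Rep 2 (Inc 1) ;; Inc 1)))
     (reg [:: m; n; k], ih, o) =
   (reg [:: 0; (iter m next (n, k)).1; (iter m next (n, k)).2], ih, o).
  elim: m n k => [|m IH] n k; first by rewrite exec_rep0.
  rewrite (exec_repS _ _ (n := m)) //= exec_if /= -/(iter m.+1 next (n, k)) iterSr.
  case: n => [|n] /=; first by rewrite exec_seq rep_move //= exec_inc /= IH addn0.
  by rewrite exec_seq exec_dec /= exec_inc /= IH.
rewrite H exec_seq !rep_move //= !addn0.
have -> // : iter z next (0, 0) = unpairn z.
by elim: z => //= z ->; rewrite /next; case: (unpairn z) => [[]].
Qed.

Lemma pair_progE n k ih o :
  ex pair_prog (reg [:: 0; n; k], ih, o) = (reg [:: pairn n k], ih, o).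
Proof.
rewrite -(reg_pad 3 [:: _]) /pair_prog exec_seq /=.
have H1 j x y : ex (Rep 2 (Inc 1 ;; Inc 0)) (reg [:: x; y; j], ih, o) =
    (reg [:: x + j; y + j; 0], ih, o).
  elim: j x y => [|j IH] x y; first by rewrite exec_rep0 // !addn0.
  by rewrite (exec_repS _ _ (n := j)) //= exec_seq !exec_inc /= IH !addSnnS.
have H2 j x m y : ex (Rep 3 (Inc 0 ;; Inc 2)) (reg [:: x; m; y; j], ih, o) =
    (reg [:: x + j; m; y + j; 0], ih, o).
  elim: j x y => [|j IH] x y; first by rewrite exec_rep0 // !addn0.
  by rewrite (exec_repS _ _ (n := j)) //= exec_seq !exec_inc /= IH !addSnnS.
have H3 m j : ex (Rep 1 (Inc 3 ;; Rep 3 (Inc 0 ;; Inc 2) ;; Rep 2 (Inc 3)))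
    (reg [:: (j * j.+1)./2 + k; m; 0; j], ih, o) =
    (reg [:: ((m + j) * (m + j).+1)./2 + k; 0; 0; m + j], ih, o).
  elim: m j => [|m IH] j; first by rewrite exec_rep0.
  rewrite addSnnS -IH (exec_repS _ _ (n := m)) // !exec_seq exec_inc H2 rep_move //.
  by rewrite half_pronicS addnAC /= addn0.
rewrite H1 add0n exec_seq -(reg_pad 1 [:: _; _; _]) /=.
have := H3 (n + k) 0; rewrite mul0n add0n addn0 => ->.
by rewrite rep_clear.
Qed.

Lemma progE c x ih o : ex (prog c) (reg [:: x], ih, o) = (reg [:: ev c x], ih, o).
Proof.
elim: c x ih o => [| | | | |f IHf g IHg|f IHf g IHg|f IHf] x ih o /=.
- by rewrite rep_clear.
- by rewrite exec_inc.
- by rewrite exec_skip.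
- by rewrite exec_seq unpair_progE rep_clear /= -(reg_pad 1 [:: _]).
- by rewrite exec_seq unpair_progE exec_seq rep_clear /= rep_move //= addn0
    -(reg_pad 1 [:: _]).
- by rewrite exec_seq IHg IHf.
- rewrite exec_seq copy_progE exec_seq (exec_under _ (IHf _ _ _)).
  rewrite exec_seq rep_move //= addn0 exec_seq.
  by rewrite (exec_under _ (exec_under _ (IHg _ _ _))) pair_progE.
rewrite exec_seq unpair_progE exec_seq.
case: (unpairn x) => n y /=.
have -> : ex (Rep 0 (Under (prog f))) (reg [:: n; y], ih, o) =
    (reg [:: 0; iter n (ev f) y], ih, o).
  elim: n y => [|n IH] y; first by rewrite exec_rep0.
  by rewrite (exec_repS _ _ (n := n)) //= (exec_under _ (IHf _ _ _)) IH -iterS iterSr.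
by rewrite rep_move //= addn0 -(reg_pad 1 [:: _]).
Qed.

End Programs.

(** * Machines that process ever longer prefixes of the input *)

Fixpoint bits_code (p : baire) (z : nat) : nat :=
  if z is z'.+1 then (pairn (tape_of p z') (bits_code p z')).+1 else 0.
Arguments bits_code : simpl never.

Section Stream.
Variables (A : Type) (silent : pred A) (quiet : A) (blocks : seq (pr * A)).
Hypothesis silent_quiet : silent quiet.
Hypothesis blocks_loud : all (fun b => ~~ silent b.2) blocks.

Definition emission (z : nat) : seq A :=
  flatten [seq nseq (ev b.1 z) b.2 | b <- blocks].

Definition emit_prog : cmd A :=
  foldr (fun b c => copy_prog A ;; Under (prog A b.1) ;; Rep 1 (Out b.2) ;; c)
    Skip blocks.

(** [bits_code] has the newest cell in front, so that absorbing one more cell costs one pairing and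
    one increment. *)
Definition stream_body : cmd A :=
  In 1 ;; Rep 0 (Inc 2) ;; pair_prog A ;; Inc 0 ;; emit_prog.

Definition stream_code : seq (instr A) :=
  compile 0 0 stream_body ++ [:: IJmp 0].

Lemma rep_outE p n a l ih o : ~~ silent a -> nth 0 l 1 = n ->
  exec silent p (Rep 1 (Out a)) (reg l, ih, o) =
  (reg (set_nth 0 l 1 0), ih, o ++ nseq n a).
Proof.
move=> na; elim: n l o => [|n IH] l o E.
  rewrite exec_rep0 // cats0 -upd_reg; congr (_, _, _).
  by apply: funext => k; rewrite /upd; case: eqP => [->|].
rewrite (exec_repS _ _ (n := n)) // exec_out // IH ?nth_set_nth //=.
by rewrite set_set_nth eqxx cat_rcons.
Qed.

Lemma emit_progE p x ih o :
  exec silent p emit_prog (reg [:: x], ih, o) = (reg [:: x], ih, o ++ emission x).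
Proof.
rewrite /emit_prog /emission; elim: blocks blocks_loud o => [|[c a] bs IH] /= loud o.
  by rewrite exec_skip cats0.
case/andP: loud => la lbs.
rewrite exec_seq copy_progE exec_seq (exec_under _ (progE _ _ _ _ _ _)).
rewrite exec_seq (rep_outE _ (n := ev c x)) //= -(reg_pad 1 [:: x]) [X in reg X]/=.
by rewrite (reg_pad 1 [:: x]) IH // catA.
Qed.

Lemma stream_bodyE p z o :
  exec silent p stream_body (reg [:: bits_code p z], z, o) =
  (reg [:: bits_code p z.+1], z.+1, o ++ emission (bits_code p z.+1)).
Proof.
rewrite /stream_body exec_seq -(reg_pad 1 [:: bits_code p z]) exec_in /= addn0.
rewrite exec_seq rep_move //= addn0 exec_seq pair_progE exec_seq exec_inc /=.
exact: emit_progE.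
Qed.

Lemma wf_stream_body : wf stream_body.
Proof.
rewrite /stream_body /emit_prog /=.
by elim: (blocks) => //= b bs ->; rewrite wf_prog.
Qed.

(** The loop runs forever, one round per input cell, and [tau z] is the time after z rounds. The
    bound [z <= tau z] lets every time be overtaken by the end of some round. *)
Lemma stream_machine : exists M : machine A, forall p, exists tau : nat -> nat,
  forall z, z <= tau z /\
    [seq a <- trace M p (tau z) init_config | ~~ silent a] =
    flatten [seq emission (bits_code p k) | k <- iota 1 z].
Proof.
exists (flat_machine quiet stream_code) => p.
set M := flat_machine _ _.
have H z : exists t, z <= t /\
    iter t (step M p) init_config =
      fconf stream_code 0 Exec (reg [:: bits_code p z]) z 0 /\
    [seq a <- trace M p t init_config | ~~ silent a] =
    flatten [seq emission (bits_code p k) | k <- iota 1 z].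
  elim: z => [|z [t [letz [E1 E2]]]].
    have [t [/= E1 E2]] := flat_init stream_code silent_quiet p [::].
    exists t; split=> //; split; last by rewrite -E2.
    by rewrite E1; congr fconf; apply: funext => -[|[]].
  have C : code_at stream_code 0 stream_code by move=> k i; rewrite add0n.
  have [C1 /code_at_cons[C2 _]] := code_at_cat C.
  have R1 := compile_correct p silent_quiet (b := 0) (pc := 0) (code := stream_code)
    (fun=> 0) (reg [:: bits_code p z], z, [::]) wf_stream_body C1.
  rewrite /gluec stream_bodyE /= in R1.
  have G s : glue 0 (fun=> 0) s = s by apply: funext => r; rewrite /glue subn0.
  rewrite !G in R1.
  have R2 := flat_jmp silent_quiet p (reg [:: bits_code p z.+1]) z.+1
    (emission (bits_code p z.+1)) C2.
  have [t' [E3 E4]] := reach_trans R1 R2; rewrite /= in E3 E4.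
  exists (t + t'); split; last split.
  (* A round takes at least one step, because it moves the input head. *)
  - rewrite -addn1 leq_add //; case: t' E3 {E4} => //= /(congr1 input_head) /= /eqP.
    by rewrite -[z == _]/(z == z.+1) ltn_eqF.
  - by rewrite addnC iterD E1.
  by rewrite trace_add filter_cat E1 -E4 E2 -[z.+1]addn1 iotaD map_cat flatten_cat
    /= cats0 add1n addn1.
by have /choice[tau tauP] := H; exists tau => z; have [? [_ ?]] := tauP z.
Qed.

End Stream.

(** * Primitive recursion on coded data types *)

Lemma seq_of_natK : cancel seq_of_nat nat_of_seq.
Proof.
have H z m : z <= m -> nat_of_seq (seq_of_nat_rec m z) = z.
  elim: m z => [|m IH] [|z] //=; rewrite ltnS => lem.
  rewrite IH ?unpairnK //; apply: leq_trans lem.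
  by rewrite -{2}(unpairnK z) /pairn leq_addl.
by move=> z; exact: H.
Qed.

(** [default] serves as the head of an empty list in the iteration behind [PR_foldl]. *)
Structure codeType := CodeType {
  csort :> Type; encode : csort -> nat; default : csort }.

Canonical nat_codeType := @CodeType nat id 0.
Canonical bool_codeType := @CodeType bool nat_of_bool false.
Canonical prod_codeType (A B : codeType) :=
  @CodeType (A * B) (fun x => pairn (encode x.1) (encode x.2))
    (default A, default B).
Canonical seq_codeType (A : codeType) :=
  @CodeType (seq A) (fun s => nat_of_seq (map (@encode A) s)) [::].

Variant PR (A B : codeType) (f : A -> B) : Prop :=
  PRIntro c & forall a, ev c (encode a) = encode (f a).

Section Closure.
Variable X : codeType.

Lemma PR_id : PR (fun x : X => x).
Proof. by exists Id. Qed.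

Lemma PR_comp (A B : codeType) (g : A -> B) (f : X -> A) :
  PR g -> PR f -> PR (fun x => g (f x)).
Proof. by move=> [c E] [d F]; exists (Comp c d) => x; rewrite /= F E. Qed.

Lemma PR_const (B : codeType) (b : B) : PR (fun _ : X => b).
Proof.
suff [c E] : exists c, forall x, ev c x = encode b by exists c => x; rewrite E.
have [n ->] : exists n, encode b = n by exists (encode b).
elim: n => [|n [c E]]; first by exists Zero.
by exists (Comp Succ c) => x /=; rewrite E.
Qed.

Lemma PR_succ (f : X -> nat) : PR f -> PR (fun x => (f x).+1).
Proof. by apply: PR_comp; exists Succ. Qed.

Lemma PR_pair (A B : codeType) (f : X -> A) (g : X -> B) :
  PR f -> PR g -> PR (fun x => (f x, g x)).
Proof. by move=> [c E] [d F]; exists (Pair c d) => x; rewrite /= E F. Qed.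

Lemma PR_fst (A B : codeType) (f : X -> A * B) :
  PR f -> PR (fun x => (f x).1).
Proof. by apply: PR_comp; exists Fst => x /=; rewrite pairnK. Qed.

Lemma PR_snd (A B : codeType) (f : X -> A * B) :
  PR f -> PR (fun x => (f x).2).
Proof. by apply: PR_comp; exists Snd => x /=; rewrite pairnK. Qed.

(** A number is itself the code of the pair that it decodes to, so on codes the decoding is [Id];
    likewise for lists below. *)
Lemma PR_unpairn (f : X -> nat) : PR f -> PR (fun x => unpairn (f x)).
Proof. by apply: PR_comp; exists Id => x /=; rewrite unpairnK. Qed.

Lemma PR_seq_of_nat (f : X -> nat) : PR f -> PR (fun x => seq_of_nat (f x)).
Proof. by apply: PR_comp; exists Id => x /=; rewrite map_id seq_of_natK. Qed.

(** The parameter x travels along in the first component of the iterated pair. *)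
Lemma PR_iter (B : codeType) (F : X -> B -> B) (n : X -> nat) (b : X -> B) :
  PR (fun w : X * B => F w.1 w.2) -> PR n -> PR b ->
  PR (fun x => iter (n x) (F x) (b x)).
Proof.
move=> [c E] [d G] [e K].
exists (Comp Snd (Comp (Iter (Pair Fst c)) (Pair d (Pair Id e)))) => x /=.
rewrite pairnK /= G K /=.
suff -> : iter (n x) (fun z => pairn (unpairn z).1 (ev c z))
    (pairn (encode x) (encode (b x)))
  = pairn (encode x) (encode (iter (n x) (F x) (b x))) by rewrite pairnK.
elim: (n x) => //= m ->; rewrite pairnK /=.
by have /= -> := E (x, iter m (F x) (b x)).
Qed.

Lemma PR_nat_of_bool (f : X -> bool) : PR f -> PR (fun x => nat_of_bool (f x)).
Proof. by move=> [c E]; exists c. Qed.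

(** A branch is an iteration with 0 or 1 rounds, whose body ignores the accumulator. *)
Lemma PR_if (B : codeType) (f : X -> bool) (a b : X -> B) :
  PR f -> PR a -> PR b -> PR (fun x => if f x then a x else b x).
Proof.
move=> hf ha hb.
have [c E] : PR (fun x => iter (f x) (fun _ => a x) (b x)).
  apply: (PR_iter (F := fun x _ => a x)) => //; last exact: PR_nat_of_bool.
  by case: ha => c E; exists (Comp c Fst) => w; rewrite /= pairnK E.
by exists c => x; rewrite E; case: (f x).
Qed.

Lemma PR_ext (A : codeType) (g f : X -> A) : f =1 g -> PR g -> PR f.
Proof. by move=> fg [c E]; exists c => x; rewrite E fg. Qed.

End Closure.

(** Iterating on pairs keeps the previous value next to the current one. *)
Lemma PR_pred (X : codeType) (f : X -> nat) : PR f -> PR (fun x => (f x).-1).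
Proof.
move=> hf.
apply: (PR_ext (g := fun x => (iter (f x) (fun w => (w.2, w.2.+1)) (0, 0)).1)).
  move=> x; have -> : iter (f x) (fun w => (w.2, w.2.+1)) (0, 0) = ((f x).-1, f x).
    by elim: (f x) => //= n ->.
  by [].
apply: PR_fst; apply: (PR_iter (F := fun _ w => (w.2, w.2.+1))) => //; last exact: PR_const.
by apply: PR_pair; [|apply: PR_succ]; apply: PR_snd; apply: PR_snd; exact: PR_id.
Qed.

Lemma PR_sub (X : codeType) (f g : X -> nat) : PR f -> PR g -> PR (fun x => f x - g x).
Proof.
move=> hf hg; apply: (PR_ext (g := fun x => iter (g x) predn (f x))).
  by move=> x; rewrite iter_predn.
apply: (PR_iter (F := fun _ => predn)) => //.
by apply: PR_pred; apply: PR_snd; exact: PR_id.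
Qed.

Lemma PR_eq0 (X : codeType) (f : X -> nat) : PR f -> PR (fun x => f x == 0).
Proof.
move=> hf; apply: (PR_ext (g := fun x => iter (f x) (fun _ => false) true)).
  by move=> x; case: (f x).
by apply: (PR_iter (F := fun _ _ => false)) => //; exact: PR_const.
Qed.

Lemma PR_not (X : codeType) (f : X -> bool) : PR f -> PR (fun x => ~~ f x).
Proof.
move=> hf; apply: (PR_ext (g := fun x => if f x then false else true)).
  by move=> x; case: (f x).
by apply: PR_if => //; exact: PR_const.
Qed.

Lemma PR_and (X : codeType) (f g : X -> bool) : PR f -> PR g -> PR (fun x => f x && g x).
Proof. by move=> hf hg; apply: PR_if => //; exact: PR_const. Qed.

Lemma PR_leq (X : codeType) (f g : X -> nat) : PR f -> PR g -> PR (fun x => f x <= g x).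
Proof. by move=> hf hg; apply: PR_eq0; exact: PR_sub. Qed.

Lemma PR_eqn (X : codeType) (f g : X -> nat) : PR f -> PR g -> PR (fun x => f x == g x).
Proof.
move=> hf hg; apply: (PR_ext (g := fun x => (f x <= g x) && (g x <= f x))).
  by move=> x; rewrite eqn_leq.
by apply: PR_and; exact: PR_leq.
Qed.

Lemma PR_eqb (X : codeType) (f g : X -> bool) : PR f -> PR g -> PR (fun x => f x == g x).
Proof.
move=> hf hg; apply: (PR_ext (g := fun x => f x == g x :> nat)).
  by move=> x; case: (f x); case: (g x).
by apply: PR_eqn; exact: PR_nat_of_bool.
Qed.

Lemma PR_behead (X A : codeType) (f : X -> seq A) : PR f -> PR (fun x => behead (f x)).
Proof.
apply: PR_comp.
have [c E] : PR (fun z : nat => (unpairn z.-1).2).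
  by apply: PR_snd; apply: PR_unpairn; apply: PR_pred; exact: PR_id.
by exists c => -[|a s]; rewrite (E (nat_of_seq _)) //= pairnK.
Qed.

Lemma PR_nilp (X A : codeType) (f : X -> seq A) : PR f -> PR (fun x => nilp (f x)).
Proof.
apply: PR_comp; have [c E] : PR (fun z : nat => z == 0).
  by apply: PR_eq0; exact: PR_id.
by exists c => -[|a s]; rewrite (E (nat_of_seq _)).
Qed.

Lemma PR_head (X A : codeType) (d : X -> A) (f : X -> seq A) :
  PR d -> PR f -> PR (fun x => head (d x) (f x)).
Proof.
move=> hd hf.
apply: (PR_comp (g := fun w : A * seq A => head w.1 w.2)
  (f := fun x => (d x, f x))); last exact: PR_pair.
have [c E] : PR (fun w : nat * nat => if w.2 == 0 then w.1 else (unpairn w.2.-1).1).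
  have P2 : PR (fun w : nat * nat => w.2) by apply: PR_snd; exact: PR_id.
  apply: PR_if; first exact: PR_eq0.
    by apply: PR_fst; exact: PR_id.
  by apply: PR_fst; apply: PR_unpairn; exact: PR_pred.
exists c => -[a s]; have /= -> := E (encode a, encode s).
by case: s => //= b s; rewrite pairnK.
Qed.

Lemma PR_cons (X A : codeType) (a : X -> A) (f : X -> seq A) :
  PR a -> PR f -> PR (fun x => a x :: f x).
Proof.
by move=> [c E] [d F]; exists (Comp Succ (Pair c d)) => x; rewrite /= E F.
Qed.

Lemma size_le_encode (A : codeType) (s : seq A) : size s <= encode s.
Proof.
elim: s => //= a s IH; apply: leq_ltn_trans IH _.
by rewrite ltnS /pairn leq_addl.
Qed.

(** The code of a list is at least its length and serves as the number of rounds; once the list is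
    used up, a round changes nothing. *)
Lemma PR_foldl (X A B : codeType) (F : X -> B -> A -> B) (b : X -> B)
    (s : X -> seq A) :
  PR (fun w : X * (B * A) => F w.1 w.2.1 w.2.2) -> PR b -> PR s ->
  PR (fun x => foldl (F x) (b x) (s x)).
Proof.
move=> hF hb hs.
pose next x (w : B * seq A) :=
  if nilp w.2 then w else (F x w.1 (head (default A) w.2), behead w.2).
apply: (PR_ext (g := fun x => (iter (encode (s x)) (next x) (b x, s x)).1)).
  move=> x; rewrite -(subnKC (size_le_encode (s x))) addnC iterD.
  have -> : iter (size (s x)) (next x) (b x, s x) = (foldl (F x) (b x) (s x), [::]).
    by elim: (s x) (b x) => //= a l IH c; rewrite -iterS iterSr /= IH.
  have H m c : iter m (next x) (c, [::]) = (c, [::]) by elim: m => //= m ->.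
  by rewrite H.
apply: PR_fst; apply: PR_iter; last exact: PR_pair.
- have P2 : PR (fun w : X * (B * seq A) => w.2) by apply: PR_snd; exact: PR_id.
  apply: PR_if => //; first by apply: PR_nilp; exact: PR_snd.
  apply: PR_pair; last by apply: PR_behead; exact: PR_snd.
  apply: (PR_comp (g := fun w : X * (B * A) => F w.1 w.2.1 w.2.2)
    (f := fun w => (w.1, (w.2.1, head (default A) w.2.2)))) => //.
  apply: PR_pair; first by apply: PR_fst; exact: PR_id.
  apply: PR_pair; first exact: PR_fst.
  by apply: PR_head; [exact: PR_const|exact: PR_snd].
by case: hs => c E; exists c.
Qed.

Lemma PR_rev (X A : codeType) (s : X -> seq A) : PR s -> PR (fun x => rev (s x)).
Proof.
move=> hs; apply: (PR_ext (g := fun x => foldl (fun l a => a :: l) [::] (s x))).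
  move=> x; rewrite /rev -[foldl _ _ _]/(foldl _ [::] _).
  by elim: (s x) [::] => //= a l IH c; rewrite IH.
apply: (PR_foldl (F := fun _ l a => a :: l)) => //; last exact: PR_const.
by apply: PR_cons; [apply: PR_snd|apply: PR_fst]; apply: PR_snd; exact: PR_id.
Qed.

Lemma PR_foldr (X A B : codeType) (F : X -> A -> B -> B) (b : X -> B)
    (s : X -> seq A) :
  PR (fun w : X * (B * A) => F w.1 w.2.2 w.2.1) -> PR b -> PR s ->
  PR (fun x => foldr (F x) (b x) (s x)).
Proof.
move=> hF hb hs.
apply: (PR_ext (g := fun x => foldl (fun u v => F x v u) (b x) (rev (s x)))).
  by move=> x; rewrite foldl_rev.
by apply: (PR_foldl (F := fun x u v => F x v u)) => //; exact: PR_rev.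
Qed.

Ltac pr_hyp :=
  match goal with h : PR ?f |- PR (fun x => ?f (@?g x)) =>
    apply: (PR_comp (g := f) (f := g)) end.

Ltac pr_base :=
  lazymatch goal with
  | |- PR (fun x => S (@?f x)) => apply: PR_succ
  | |- PR (fun x => (@?f x, @?g x)) => apply: PR_pair
  | |- PR fst => exact: (PR_fst (f := fun x => x) (PR_id _))
  | |- PR snd => exact: (PR_snd (f := fun x => x) (PR_id _))
  | |- PR (fun x => fst (@?f x)) => apply: PR_fst
  | |- PR (fun x => snd (@?f x)) => apply: PR_snd
  | |- PR (fun x => unpairn (@?f x)) => apply: PR_unpairn
  | |- PR (fun x => seq_of_nat (@?f x)) => apply: PR_seq_of_nat
  | |- PR (fun x => nat_of_bool (@?f x)) => apply: PR_nat_of_bool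
  | |- PR (fun x => (@?f x).-1) => apply: PR_pred
  | |- PR (fun x => ~~ @?f x) => apply: PR_not
  | |- PR (fun x => @?f x && @?g x) => apply: PR_and
  | |- PR (fun x => @?f x <= @?g x) => apply: PR_leq
  | |- PR (fun x => @?f x == @?g x) => first [apply: PR_eqn | apply: PR_eqb]
  | |- PR (fun x => nilp (@?s x)) => apply: PR_nilp
  | |- PR (fun x => behead (@?s x)) => apply: PR_behead
  | |- PR (fun x => head (@?d x) (@?s x)) => apply: PR_head
  | |- PR (fun x => @?a x :: @?s x) => apply: PR_cons
  | |- PR (fun x => rev (@?s x)) => apply: PR_rev
  end.

(** These hooks are rebound as soon as closure lemmas for list functions and for the parts of the
    simulator are available. *)
Ltac pr_more := fail.
Ltac pr_sim := fail.

Ltac pr := repeat first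
  [ assumption | exact: PR_id | exact: PR_const | pr_hyp | pr_base | pr_more
  | pr_sim | apply: PR_if ].

Lemma PR_comp2 (X A B C : codeType) (F : A -> B -> C) (f : X -> A) (g : X -> B) :
  PR (fun w : A * B => F w.1 w.2) -> PR f -> PR g -> PR (fun x => F (f x) (g x)).
Proof.
move=> hF hf hg.
exact: (PR_comp (g := fun w : A * B => F w.1 w.2) (f := fun x => (f x, g x))
  hF (PR_pair hf hg)).
Qed.

Lemma PR_map (X A B : codeType) (F : X -> A -> B) (s : X -> seq A) :
  PR (fun w : X * A => F w.1 w.2) -> PR s -> PR (fun x => map (F x) (s x)).
Proof.
move=> hF hs.
apply: (PR_foldr (F := fun x a l => F x a :: l) (b := fun _ => [::])); pr.
by apply: (PR_comp2 (F := F)); pr.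
Qed.

Lemma PR_filter (X A : codeType) (F : X -> A -> bool) (s : X -> seq A) :
  PR (fun w : X * A => F w.1 w.2) -> PR s -> PR (fun x => [seq a <- s x | F x a]).
Proof.
move=> hF hs.
apply: (PR_foldr (F := fun x a l => if F x a then a :: l else l) (b := fun _ => [::])); pr.
by apply: (PR_comp2 (F := F)); pr.
Qed.

Lemma PR_has (X A : codeType) (F : X -> A -> bool) (s : X -> seq A) :
  PR (fun w : X * A => F w.1 w.2) -> PR s -> PR (fun x => has (F x) (s x)).
Proof.
move=> hF hs; apply: (PR_ext (g := fun x => ~~ nilp ([seq a <- s x | F x a]))).
  by move=> x; elim: (s x) => //= a l ->; case: (F x a).
by apply: PR_not; apply: PR_nilp; apply: (PR_filter (F := F)).
Qed.

Lemma PR_size (X A : codeType) (s : X -> seq A) : PR s -> PR (fun x => size (s x)).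
Proof.
by move=> hs; apply: (PR_foldr (F := fun _ _ n => n.+1) (b := fun _ => 0)); pr.
Qed.

Lemma PR_drop (X A : codeType) (n : X -> nat) (s : X -> seq A) :
  PR n -> PR s -> PR (fun x => drop (n x) (s x)).
Proof.
move=> hn hs; apply: (PR_ext (g := fun x => iter (n x) behead (s x))).
  move=> x; elim: (n x) (s x) => [|m IH] l; first by rewrite drop0.
  by rewrite iterSr -IH; case: l.
by apply: (PR_iter (F := fun _ l => behead l)); pr.
Qed.

Lemma PR_nth (X A : codeType) (d : X -> A) (n : X -> nat) (s : X -> seq A) :
  PR d -> PR n -> PR s -> PR (fun x => nth (d x) (s x) (n x)).
Proof.
move=> hd hn hs; apply: (PR_ext (g := fun x => head (d x) (drop (n x) (s x)))).
  by move=> x; rewrite -nth0 nth_drop addn0.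
by pr; exact: PR_drop.
Qed.

Lemma PR_cat (X A : codeType) (s t : X -> seq A) :
  PR s -> PR t -> PR (fun x => s x ++ t x).
Proof.
move=> hs ht; apply: (PR_ext (g := fun x => foldr cons (t x) (s x))).
  by move=> x; elim: (s x) => //= a l ->.
by apply: (PR_foldr (F := fun _ a l => a :: l)); pr.
Qed.

Lemma PR_flatten (X A : codeType) (s : X -> seq (seq A)) :
  PR s -> PR (fun x => flatten (s x)).
Proof.
move=> hs; apply: (PR_foldr (F := fun _ a l => a ++ l) (b := fun _ => [::])); pr.
by apply: PR_cat; pr.
Qed.

Lemma PR_index_true (X : codeType) (s : X -> seq bool) :
  PR s -> PR (fun x => index true (s x)).
Proof.
move=> hs.
apply: (PR_ext (g := fun x => foldr (fun a n => if a then 0 else n.+1) 0 (s x))).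
  by move=> x; elim: (s x) => //= -[] l //= ->.
by apply: (PR_foldr (F := fun _ (a : bool) n => if a then 0 else n.+1) (b := fun _ => 0)); pr.
Qed.

Lemma PR_iota0 (X : codeType) (n : X -> nat) : PR n -> PR (fun x => iota 0 (n x)).
Proof.
move=> hn.
apply: (PR_ext (g := fun x =>
  rev (iter (n x) (fun w => (w.1.+1, w.1 :: w.2)) (0, [::])).2)).
  move=> x; have -> : iter (n x) (fun w => (w.1.+1, w.1 :: w.2)) (0, [::]) =
      (n x, rev (iota 0 (n x))).
    have H m : rev (iota 0 m.+1) = m :: rev (iota 0 m) by rewrite -addn1 iotaD rev_cat.
    by elim: (n x) => // m; rewrite iterS H => ->.
  by rewrite revK.
pr; apply: (PR_iter (F := fun _ w => (w.1.+1, w.1 :: w.2)) (b := fun _ => (0, [::]))); pr.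
Qed.

Ltac pr_more ::=
  lazymatch goal with
  | |- PR (fun x => size (@?s x)) => apply: PR_size
  | |- PR (fun x => drop (@?n x) (@?s x)) => apply: PR_drop
  | |- PR (fun x => nth (@?d x) (@?s x) (@?n x)) => apply: PR_nth
  | |- PR (fun x => @?s x ++ @?t x) => apply: PR_cat
  | |- PR (fun x => flatten (@?s x)) => apply: PR_flatten
  | |- PR (fun x => index true (@?s x)) => apply: PR_index_true
  | |- PR (fun x => iota 0 (@?n x)) => apply: PR_iota0
  | |- PR (fun x => map (@?F x) (@?s x)) => apply: PR_map
  | |- PR (fun x => seq.filter (@?F x) (@?s x)) => apply: PR_filter
  | |- PR (fun x => has (@?F x) (@?s x)) => apply: PR_has
  end.

(** * A primitive recursive simulator *)

(* state, input head, work head, and the log of the writes to the work tape,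
   most recent first *)
Definition sconfig : Type := nat * (nat * (nat * seq (nat * nat))).

Definition lookup (log : seq (nat * nat)) (m : nat) : nat :=
  head 0 [seq e.2 | e <- log & e.1 == m].

(** Cells beyond [T] read as 0. Hence [[::]] is the complete tape of 0^omega and [[:: v]] that of a
    name with v as its only possibly nonzero entry; for other inputs [T] must cover the cells that
    are visited. *)
Definition sapplicable (T : seq bool) (c : sconfig) (a : seq nat) : bool :=
  [&& nth 0 a 0 == c.1, (nth 0 a 1 != 0) == nth false T c.2.1 &
      nth 0 a 2 == lookup c.2.2.2 c.2.2.1].

Definition srules (i : nat) (T : seq bool) (c : sconfig) : seq (seq nat) :=
  [seq a <- map seq_of_nat (seq_of_nat i) | sapplicable T c a].

Definition sshift (a h : nat) : nat :=
  if a == 0 then h.-1 else if a == 1 then h else h.+1.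

Definition sstep (i : nat) (T : seq bool) (c : sconfig) : sconfig :=
  let s := srules i T c in
  let a := head [::] s in
  if nilp s then c else
  (nth 0 a 3, (sshift (nth 0 a 5) c.2.1, (sshift (nth 0 a 6) c.2.2.1,
    (c.2.2.1, nth 0 a 4) :: c.2.2.2))).

Definition srun (i : nat) (T : seq bool) (t : nat) : sconfig :=
  iter t (sstep i T) (0, (0, (0, [::]))).

Definition shalts (i : nat) (T : seq bool) (t : nat) : bool :=
  nilp (srules i T (srun i T t)).

(** Under [output_of_nat] the rules that append a 1 are those whose field 7 exceeds 1. *)
Definition semits (i : nat) (T : seq bool) (t : nat) : bool :=
  let s := srules i T (srun i T t) in
  ~~ nilp s && (1 < nth 0 (head [::] s) 7).

(** The tape of <h, 0^i 1 0^omega> up to entry 2n - 1, with h replaced by its approximation at stage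
    s. *)
Definition oracle_tape (s i n : nat) : seq bool :=
  flatten [seq (nseq (shalts k [::] s) true ++ [:: false]) ++
               (nseq (k == i) true ++ [:: false]) | k <- iota 0 n].

(** Up to step j only cells 0 to j are visited, and the listed entries fill at least 2(j + 1)
    cells. *)
Definition semits_first (s i j : nat) : bool :=
  let T := oracle_tape s i j.+1 in
  semits i T j && ~~ has (semits i T) (iota 0 j).

(** Up to the first 1 the cells match the entries of x one to one; the entry 1 itself occupies the
    cells [i] and [i.+1], so the search for the second 1 resumes at cell [i.+2]. The length of [l]
    is also the stage at which h is approximated. *)
Definition guess (l : seq bool) : bool :=
  let i := index true l in
  let l' := drop i.+2 l in
  let j := index true l' in
  if i < size l then (if j < size l' then ~~ semits_first (size l) i j else true)
  else false.

(** A prefix of length [(pairn s e).+1] yields bit e of the s-th approximation to the jump, so each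
    further input cell produces one further output entry. *)
Definition low_bit (l : seq bool) : bool :=
  let w := unpairn (size l).-1 in shalts w.2 [:: guess l] w.1.

Lemma PR_lookup (X : codeType) (l : X -> seq (nat * nat)) (m : X -> nat) :
  PR l -> PR m -> PR (fun x => lookup (l x) (m x)).
Proof. by move=> hl hm; rewrite /lookup; pr. Qed.

Ltac pr_sim ::=
  lazymatch goal with
  | |- PR (fun x => lookup (@?l x) (@?m x)) => apply: PR_lookup
  end.

Lemma PR_srules (X : codeType) i T (c : X -> sconfig) :
  PR i -> PR T -> PR c -> PR (fun x => srules (i x) (T x) (c x)).
Proof.
move=> hi hT hc; rewrite /srules.
apply: PR_filter; last first.
  by apply: (PR_map (F := fun _ => seq_of_nat)); pr.
rewrite /sapplicable.
pr.
Qed.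

Lemma PR_sshift (X : codeType) (a h : X -> nat) :
  PR a -> PR h -> PR (fun x => sshift (a x) (h x)).
Proof. by move=> ha hh; rewrite /sshift; pr. Qed.

Lemma PR_sstep (X : codeType) i T (c : X -> sconfig) :
  PR i -> PR T -> PR c -> PR (fun x => sstep (i x) (T x) (c x)).
Proof.
move=> hi hT hc; have hs := PR_srules hi hT hc; rewrite /sstep; apply: PR_if; pr.
all: by apply: PR_sshift; pr.
Qed.

Lemma PR_srun (X : codeType) (i : X -> nat) T (t : X -> nat) :
  PR i -> PR T -> PR t -> PR (fun x => srun (i x) (T x) (t x)).
Proof.
move=> hi hT ht.
apply: (PR_iter (F := fun x c => sstep (i x) (T x) c)
  (b := fun _ => (0, (0, (0, [::]))))) => //; last exact: PR_const.
by apply: PR_sstep; pr.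
Qed.

Lemma PR_shalts (X : codeType) (i : X -> nat) T (t : X -> nat) :
  PR i -> PR T -> PR t -> PR (fun x => shalts (i x) (T x) (t x)).
Proof.
by move=> hi hT ht; apply: PR_nilp; apply: PR_srules => //; exact: PR_srun.
Qed.

Lemma PR_semits (X : codeType) (i : X -> nat) T (t : X -> nat) :
  PR i -> PR T -> PR t -> PR (fun x => semits (i x) (T x) (t x)).
Proof.
move=> hi hT ht; have hs := PR_srules hi hT (PR_srun hi hT ht).
by rewrite /semits; pr.
Qed.

Lemma PR_nseq_true (X : codeType) (b : X -> bool) :
  PR b -> PR (fun x => nseq (b x) true).
Proof.
move=> hb; apply: (PR_ext (g := fun x => if b x then [:: true] else [::])).
  by move=> x; case: (b x).
by pr.
Qed.

Ltac pr_sim ::=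
  lazymatch goal with
  | |- PR (fun x => nseq (nat_of_bool (@?b x)) true) => apply: PR_nseq_true
  | |- PR (fun x => shalts (@?i x) (@?T x) (@?t x)) => apply: PR_shalts
  | |- PR (fun x => semits (@?i x) (@?T x) (@?t x)) => apply: PR_semits
  end.

Lemma PR_oracle_tape (X : codeType) (s i n : X -> nat) :
  PR s -> PR i -> PR n -> PR (fun x => oracle_tape (s x) (i x) (n x)).
Proof. by move=> hs hi hn; rewrite /oracle_tape; pr. Qed.

Lemma PR_semits_first (X : codeType) (s i j : X -> nat) :
  PR s -> PR i -> PR j -> PR (fun x => semits_first (s x) (i x) (j x)).
Proof.
move=> hs hi hj; rewrite /semits_first.
have hT : PR (fun x => oracle_tape (s x) (i x) (j x).+1).
  by apply: PR_oracle_tape; pr.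
apply: PR_and; first by pr.
apply: PR_not; apply: (PR_has
  (F := fun x => semits (i x) (oracle_tape (s x) (i x) (j x).+1))).
  by pr; apply: PR_oracle_tape; pr.
by pr.
Qed.

Ltac pr_sim ::=
  lazymatch goal with
  | |- PR (fun x => shalts (@?i x) (@?T x) (@?t x)) => apply: PR_shalts
  | |- PR (fun x => semits_first (@?s x) (@?i x) (@?j x)) => apply: PR_semits_first
  end.

Lemma PR_guess (X : codeType) (l : X -> seq bool) : PR l -> PR (fun x => guess (l x)).
Proof.
by move=> hl; rewrite /guess; pr.
Qed.

Lemma PR_low_bit (X : codeType) (l : X -> seq bool) :
  PR l -> PR (fun x => low_bit (l x)).
Proof.
move=> hl; have hg := PR_guess hl; rewrite /low_bit.
by apply: PR_shalts; pr.
Qed.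

(** * Tapes and correctness of the simulator *)

Definition unary (p : baire) (n : nat) : seq bool :=
  flatten [seq nseq (p k) true ++ [:: false] | k <- iota 0 n].

Lemma unaryS p n : unary p n.+1 = unary p n ++ nseq (p n) true ++ [:: false].
Proof. by rewrite /unary -addn1 iotaD map_cat flatten_cat /= cats0. Qed.

Lemma size_unary p n : size (unary p n) = (\sum_(i < n) p i) + n.
Proof.
elim: n => [|n IH]; first by rewrite big_ord0.
by rewrite unaryS !size_cat size_nseq IH big_ord_recr /= addn1 !addnS addnAC.
Qed.

Lemma leq_size_unary p n : n <= size (unary p n).
Proof. by rewrite size_unary leq_addl. Qed.

Lemma size_unary_mono p m n : m <= n -> size (unary p m) <= size (unary p n).
Proof.
move=> /subnKC <-; elim: (n - m) => [|k IH]; first by rewrite addn0.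
by rewrite addnS unaryS size_cat (leq_trans IH) // leq_addr.
Qed.

(** Entry n occupies the block of [p n] ones and one zero that follows [unary p n]; the zero with
    number m closes block m, and distinct blocks are disjoint. *)
Lemma tape_ofE p n c : c <= p n -> tape_of p (size (unary p n) + c) = (c < p n).
Proof.
have E m : (\sum_(i < m.+1) p i) + m = size (unary p m) + p m.
  by rewrite size_unary big_ord_recr /= addnAC.
move=> le; rewrite /tape_of; case: ltngtP le => // [lt|->] _.
  apply/negP => /existsP[m /eqP]; rewrite E => Em.
  case: (ltngtP m n) => [ltmn|ltnm|eqmn].
  - have := size_unary_mono p ltmn; rewrite unaryS !size_cat size_nseq /=; lia.
  - have := size_unary_mono p ltnm; rewrite unaryS !size_cat size_nseq /=; lia.
  - by move: Em; rewrite eqmn => /addnI Ec; rewrite Ec ltnn in lt.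
apply/negbTE; rewrite negbK; apply/existsP.
have lt : n < (size (unary p n) + p n).+1.
  by rewrite ltnS (leq_trans (leq_size_unary p n)) // leq_addr.
by exists (Ordinal lt); rewrite /= E.
Qed.

Lemma nth_unary p n h :
  h < size (unary p n) -> nth false (unary p n) h = tape_of p h.
Proof.
elim: n => [//|n IH]; rewrite unaryS nth_cat size_cat.
case: (ltnP h (size (unary p n))) => [lt _|le]; first exact: IH.
rewrite size_cat size_nseq addn1 -{1 3}(subnKC le) ltn_add2l ltnS => lec.
rewrite tape_ofE // nth_cat size_nseq nth_nseq.
by case: ltngtP lec => // ->; rewrite subnn.
Qed.

Lemma tape_of_unary p h : tape_of p h = nth false (unary p h.+1) h.
Proof. by rewrite nth_unary // (leq_trans _ (leq_size_unary p _)). Qed.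

(** Every entry takes at least one cell, so cell h belongs to one of the entries 0 to h. *)
Lemma eq_tape_of p p' h :
  (forall k, k <= h -> p k = p' k) -> tape_of p h = tape_of p' h.
Proof.
move=> E; rewrite !tape_of_unary; congr (nth _ (flatten _) _).
by apply/eq_in_map => k; rewrite mem_iota /= ltnS => /E ->.
Qed.

Lemma unary0 n : unary (fun=> 0) n = nseq n false.
Proof. by elim: n => // n IH; rewrite unaryS IH -[n.+1]addn1 nseqD. Qed.

Lemma tape_of_neq0 p h : tape_of p h -> exists2 k, k <= h & p k != 0.
Proof.
move=> ph; apply: contrapT => H; move: ph.
rewrite (@eq_tape_of p (fun=> 0)) ?tape_of_unary.
  by rewrite unary0 nth_nseq if_same.
move=> k le; apply/eqP; apply: contrapT => /negP pk; apply: H; by exists k.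
Qed.

Lemma ex_tape_of p k : p k != 0 -> exists h, tape_of p h.
Proof.
by rewrite -lt0n => pk; exists (size (unary p k) + 0); rewrite tape_ofE // ltnW.
Qed.

Definition point (v : bool) : baire := fun n => (n == 0) && v.

Lemma tape_of_point v h : tape_of (point v) h = nth false [:: v] h.
Proof.
case: h => [|h].
  have := @tape_ofE (point v) 0 0 isT; rewrite /unary /= => ->.
  by rewrite /point; case: v.
rewrite nth_default //; case: v; last first.
  case E: (tape_of _ _) => //.
  by have [k _] := tape_of_neq0 E; rewrite /point andbF.
have E n : unary (point true) n.+1 = true :: nseq n.+1 false.
  elim: n => [//|n IH]; rewrite unaryS IH cat_cons; congr (_ :: _).
  by rewrite -[in RHS](addn1 n.+1) nseqD.
by rewrite tape_of_unary E -[LHS]/(nth false (nseq h.+2 false) h) nth_nseq if_same.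
Qed.

Definition sim_rel (sc : sconfig) (c : config) : Prop :=
  [/\ sc.1 = state c, sc.2.1 = input_head c, sc.2.2.1 = work_head c &
      lookup sc.2.2.2 =1 work_tape c].

Definition rule_of_seq (a : seq nat) : rule (option bool) :=
  Rule (nth 0 a 0) (nth 0 a 1 != 0) (nth 0 a 2) (nth 0 a 3) (nth 0 a 4)
    (move_of_nat (nth 0 a 5)) (move_of_nat (nth 0 a 6)) (output_of_nat (nth 0 a 7)).

Lemma input_head_run A (M : machine A) p t : input_head (run M p t) <= t.
Proof.
elim: t => // t IH; rewrite /run iterS -/(run M p t) /step.
case: next_rule => [r|]; last exact: leqW.
rewrite /=; case: (move_input r) => /=; lia.
Qed.

Lemma sshiftE a h : sshift a h = shift (move_of_nat a) h.
Proof. by case: a => [|[|a]]. Qed.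

Lemma lookup_cons e l m : lookup (e :: l) m = if m == e.1 then e.2 else lookup l m.
Proof. by rewrite /lookup /= eq_sym; case: eqP. Qed.

Section Simulation.
Variables (i : nat) (T : seq bool) (p : baire).

Lemma srulesE sc c : sim_rel sc c ->
  nth false T (input_head c) = tape_of p (input_head c) ->
  next_rule (nth_machine i) p c = omap rule_of_seq (ohead (srules i T sc)).
Proof.
case=> e1 e2 e3 e4 Tp.
have -> : nth_machine i = map rule_of_seq (map seq_of_nat (seq_of_nat i)).
  by rewrite -map_comp.
rewrite /next_rule filter_map ohead_map /srules; congr (omap _ (ohead _)).
by apply: eq_filter => a; rewrite /sapplicable /applicable /= e1 e2 e3 e4 Tp.
Qed.

Lemma sstep_rel sc c : sim_rel sc c ->
  nth false T (input_head c) = tape_of p (input_head c) ->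
  sim_rel (sstep i T sc) (step (nth_machine i) p c).
Proof.
move=> R Tp; rewrite /step (srulesE R Tp) /sstep.
case: (srules i T sc) => [|a s] //=; case: R => e1 e2 e3 e4; split=> //=.
- by rewrite sshiftE e2.
- by rewrite sshiftE e3.
by move=> m; rewrite lookup_cons e3 /= e4.
Qed.

Lemma srun_rel t : (forall h, h < t -> nth false T h = tape_of p h) ->
  sim_rel (srun i T t) (run (nth_machine i) p t).
Proof.
elim: t => [//|t IH] Tp; rewrite /srun /run !iterS -/(srun i T t) -/(run _ p t).
apply: sstep_rel; first by apply: IH => h lt; apply: Tp; exact: ltnW.
by apply: Tp; rewrite ltnS; exact: input_head_run.
Qed.

Lemma srules_run t : (forall h, h <= t -> nth false T h = tape_of p h) ->
  next_rule (nth_machine i) p (run (nth_machine i) p t) =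
  omap rule_of_seq (ohead (srules i T (srun i T t))).
Proof.
move=> Tp; apply: srulesE; last by apply: Tp; exact: input_head_run.
by apply: srun_rel => h /ltnW; exact: Tp.
Qed.

Lemma shaltsP t : (forall h, h <= t -> nth false T h = tape_of p h) ->
  shalts i T t <-> next_rule (nth_machine i) p (run (nth_machine i) p t) = None.
Proof.
by move=> Tp; rewrite srules_run // /shalts; case: (srules _ _ _).
Qed.

Lemma semitsP t : (forall h, h <= t -> nth false T h = tape_of p h) ->
  semits i T t <-> action (nth_machine i) p t = Some (Some true).
Proof.
move=> Tp; rewrite /action srules_run // /semits.
case: (srules _ _ _) => [|a s] //=.
by case: (nth 0 a 7) => [|[|n]].
Qed.

End Simulation.

Lemma halted_mono A (M : machine A) p t t' : t <= t' ->
  next_rule M p (run M p t) = None -> next_rule M p (run M p t') = None.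
Proof.
move=> /subnKC <- E; have -> // : run M p (t + (t' - t)) = run M p t.
elim: (t' - t) => [|n IH]; first by rewrite addn0.
by rewrite addnS /run iterS -/(run M p _) IH /step E.
Qed.

(** A halted machine stays halted, so the bit changes at most once. [T] has to be right on every
    cell because s is unbounded. *)
Lemma shalts_limit i T p : (forall h, nth false T h = tape_of p h) ->
  exists s0, forall s, s0 <= s -> nat_of_bool (shalts i T s) = jump p i.
Proof.
move=> Tp; rewrite /jump; case: asboolP => [[t Et]|nh].
  exists t => s le; congr nat_of_bool; apply/(shaltsP i (fun h _ => Tp h) (t := s)).
  exact: halted_mono Et.
exists 0 => s _; congr nat_of_bool; apply/negbTE/negP.
move=> /(shaltsP i (fun h _ => Tp h) (t := s)) E; by apply: nh; exists s.
Qed.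

(** * The diagonal function *)

Definition single (i : nat) : baire := fun k => k == i.

Definition oracle_input (i : nat) : baire := interleave halting_problem (single i).

Definition emits_first (i j : nat) : Prop :=
  let emits t := action (nth_machine i) (oracle_input i) t = Some (Some true) in
  emits j /\ forall t, t < j -> ~ emits t.

Lemma interleave_even q p k : interleave q p k.*2 = q k.
Proof. by rewrite /interleave odd_double doubleK. Qed.

Lemma interleave_odd q p k : interleave q p k.*2.+1 = p k.
Proof. by rewrite /interleave /= odd_double /= uphalf_double. Qed.

Lemma unary_interleave q p n : unary (interleave q p) n.*2 =
  flatten [seq (nseq (q k) true ++ [:: false]) ++ (nseq (p k) true ++ [:: false])
          | k <- iota 0 n].
Proof.
elim: n => // n IH; rewrite doubleS !unaryS IH -[n.+1]addn1 iotaD map_cat flatten_cat /=.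
by rewrite interleave_even interleave_odd cats0 -!catA.
Qed.

Lemma shalts_limit_below n : exists s0, forall s k, s0 <= s -> k < n ->
  nat_of_bool (shalts k [::] s) = halting_problem k.
Proof.
elim: n => [|n [s0 IH]]; first by exists 0.
have [h|s1 s1P] := @shalts_limit n [::] (fun=> 0).
  by rewrite tape_of_unary unary0 nth_nseq nth_nil if_same.
exists (maxn s0 s1) => s k; rewrite geq_max => /andP[le0 le1].
by rewrite ltnS leq_eqVlt => /orP[/eqP ->|/(IH _ _ le0) //]; exact: s1P.
Qed.

(** For fixed j only the first j + 1 bits of h are consulted, and each of them settles at some
    stage. *)
Lemma semits_first_limit i j : exists s0, forall s, s0 <= s ->
  semits_first s i j = `[< emits_first i j >].
Proof.
have [s0 s0P] := shalts_limit_below j.+1; exists s0 => s les.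
have ET : oracle_tape s i j.+1 = unary (oracle_input i) j.+1.*2.
  rewrite unary_interleave /oracle_tape; congr flatten; apply/eq_in_map => k.
  by rewrite mem_iota => /andP[_ ltk]; rewrite (s0P s k les ltk).
rewrite /semits_first ET; set T := unary _ _.
have Tp t : t <= j -> forall h, h <= t -> nth false T h = tape_of (oracle_input i) h.
  move=> let_ h leh; rewrite nth_unary //; apply: leq_trans (leq_size_unary _ _).
  by rewrite -addnn; lia.
apply/idP/asboolP => [/andP[e ne]|[e ne]].
  split; first by apply/(semitsP i (Tp j (leqnn j))).
  move=> t lt /(semitsP i (Tp t (ltnW lt))) e'; case/hasP: ne; exists t => //.
  by rewrite mem_iota.
apply/andP; split; first by apply/(semitsP i (Tp j (leqnn j))).
apply/hasP => -[t]; rewrite mem_iota /= => lt /(semitsP i (Tp t (ltnW lt))).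
exact: ne.
Qed.

Definition first_true (x : nat -> bool) (i : nat) : Prop :=
  x i /\ forall k, k < i -> ~~ x k.

Lemma first_true_inj x i j : first_true x i -> first_true x j -> i = j.
Proof.
move=> [xi ni] [xj nj]; case: (ltngtP i j) => // lt.
  by rewrite (negbTE (nj _ lt)) in xi.
by rewrite (negbTE (ni _ lt)) in xj.
Qed.

Lemma ex_first_true (x : nat -> bool) : (exists i, x i) -> exists i, first_true x i.
Proof.
move=> ex; exists (ex_minn ex); case: ex_minnP => i xi min; split=> // k.
by apply: contraTN => /min; rewrite -leqNgt.
Qed.

Lemma index_mkseq x i s : first_true x i -> i < s -> index true (mkseq x s) = i.
Proof.
move=> [xi ni] lt; have := index_mem true (mkseq x s).
have -> : true \in mkseq x s by apply/mapP; exists i; rewrite ?mem_iota.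
rewrite size_mkseq; set k := index _ _ => ltx.
have xk : x k.
  rewrite -(nth_mkseq false x ltx) nth_index //.
  by apply/mapP; exists i; rewrite ?mem_iota.
case: (ltngtP k i) => // lti; first by have := ni _ lti; rewrite xk.
have := @before_find _ false (pred1 true) (mkseq x s) i lti.
by rewrite nth_mkseq //= xi.
Qed.

Lemma index_mkseqN (x : nat -> bool) s :
  (forall k, ~~ x k) -> index true (mkseq x s) = s.
Proof.
move=> nx; rewrite memNindex ?size_mkseq //.
by apply/mapP => -[k _ E]; have := nx k; rewrite -E.
Qed.

Lemma drop_mkseq T (x : nat -> T) m s :
  drop m (mkseq x s) = mkseq (fun k => x (m + k)) (s - m).
Proof.
rewrite /mkseq -map_drop drop_iota add0n -[X in iota X _](addn0 m) iotaDl -map_comp.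
by apply: eq_map => k.
Qed.

Definition tail (x : nat -> bool) (i k : nat) : bool := x (i.+1 + k).

Definition diag_spec (x : nat -> bool) : Prop :=
  exists2 i, first_true x i & forall j, first_true (tail x i) j -> ~ emits_first i j.

Definition diag (x : cantor_space) : sierpinski := `[< diag_spec x >].

Definition tape (x : cantor_space) : nat -> bool := tape_of (cantor_name x).

Lemma tape_false (x : cantor_space) k : (forall n, n <= k -> ~~ x n) -> ~~ tape x k.
Proof.
move=> nx; apply/negP; rewrite /tape; case E: tape_of => // _.
have [n le] := tape_of_neq0 E; rewrite /cantor_name.
by rewrite (negbTE (nx _ le)).
Qed.

Lemma tape_first (x : cantor_space) i : first_true x i -> first_true (tape x) i.
Proof.
move=> [xi nx]; split; last first.
  by move=> k ltk; apply: tape_false => n len; apply: nx; exact: leq_ltn_trans ltk.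
have -> : i = size (unary (cantor_name x) i) + 0.
  rewrite size_unary big1 ?addn0 // => k _; rewrite /cantor_name.
  by rewrite (negbTE (nx _ (ltn_ord k))).
by rewrite /tape tape_ofE // /cantor_name xi.
Qed.

Lemma size_unary_first (x : cantor_space) i k : first_true x i ->
  (forall n, n < k -> ~~ tail x i n) ->
  size (unary (cantor_name x) (i.+1 + k)) = i.+2 + k.
Proof.
move=> [xi nx]; elim: k => [|k IH] nt.
  rewrite !addn0 size_unary big_ord_recr /= /cantor_name xi big1 //.
  by move=> m _; rewrite (negbTE (nx _ (ltn_ord m))).
rewrite addnS unaryS size_cat IH; last by move=> n /ltnW; exact: nt.
have := nt k (ltnSn k); rewrite /tail /cantor_name => /negbTE -> /=.
by rewrite addn1 addnS.
Qed.

(** The first 1 shifts later entries by one cell; up to the second 1 there is no further shift. *)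
Lemma tape_after (x : cantor_space) i k : first_true x i ->
  (forall n, n < k -> ~~ tail x i n) -> tape x (i.+2 + k) = tail x i k.
Proof.
move=> xi nt; rewrite -(size_unary_first xi nt) -[size _]addn0 /tape tape_ofE //.
by rewrite /cantor_name /tail; case: (x _).
Qed.

(** Without a 1 all guesses are 0; with a single 1 they are 1 as soon as it is seen. With a second 1
    they also depend on the approximation to h, which may revise them finitely often. *)
Lemma guess_limit (x : cantor_space) :
  exists s0, forall s, s0 <= s -> guess (mkseq (tape x) s) = diag x.
Proof.
rewrite /diag; case: (pselect (exists i, x i)) => [/ex_first_true[i xi]|nx]; last first.
  exists 0 => s _; rewrite /guess index_mkseqN ?size_mkseq ?ltnn.
    by apply/esym/asboolPn => -[i [xi _]]; case: nx; exists i.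
  by move=> k; apply: tape_false => n _; apply/negP => xn; case: nx; exists n.
have fE : diag_spec x <-> forall j, first_true (tail x i) j -> ~ emits_first i j.
  split; last by exists i.
  by move=> [i' xi' H]; rewrite (first_true_inj xi xi').
case: (pselect (exists j, tail x i j)) => [/ex_first_true[j xj]|nx]; last first.
  exists i.+1 => s les; rewrite /guess (index_mkseq (tape_first xi)) // size_mkseq les.
  rewrite drop_mkseq index_mkseqN ?size_mkseq ?ltnn.
    apply/esym/asboolP/fE => j [xj _]; by case: nx; exists j.
  have nt k : ~~ tail x i k by apply/negP => xk; apply: nx; exists k.
  by move=> k; rewrite (tape_after xi).
have [s0 s0P] := semits_first_limit i j.
(* The prefix has to include cell [i.+2 + j], where the second 1 shows. *)
exists (maxn s0 (i.+2 + j).+1) => s; rewrite geq_max => /andP[le0 les].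
have lti : i < s by lia.
rewrite /guess (index_mkseq (tape_first xi)) // size_mkseq lti drop_mkseq.
have tj : first_true (fun k => tape x (i.+2 + k)) j.
  case: xj => xj nj; split=> [|k ltk].
    by rewrite (tape_after xi).
  rewrite (tape_after xi); first exact: nj.
  by move=> n ltn; apply: nj; exact: ltn_trans ltk.
rewrite (index_mkseq tj) ?size_mkseq; last by lia.
have -> : j < s - i.+2 by lia.
rewrite s0P // -asbool_neg; apply: asbool_equiv_eq; rewrite fE.
split=> [nb j' xj'|]; last exact.
by rewrite -(first_true_inj xj xj').
Qed.

(** * The machine with finitely many mind changes *)

Lemma bits_codeE p z :
  bits_code p z = encode (rev (mkseq (tape_of p) z) : seq_codeType bool_codeType).
Proof.
by elim: z => // z IH; rewrite mkseqS rev_rcons /= /bits_code -/(bits_code p z) IH.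
Qed.

Lemma pr_of_PR (F : seq bool -> nat) :
  @PR (seq_codeType bool_codeType) nat_codeType F ->
  exists c, forall p z, ev c (bits_code p z) = F (mkseq (tape_of p) z).
Proof.
move=> hF.
have [c E] : @PR (seq_codeType bool_codeType) nat_codeType (fun l => F (rev l)).
  exact: (PR_comp (g := F) hF (PR_rev (PR_id _))).
by exists c => p z; rewrite bits_codeE E /= revK.
Qed.

Definition loud2 (a : option bool * move) : bool :=
  ~~ (if a is (None, Stay) then true else false).

Definition act2 (x : nat * (nat -> option bool)) (a : option bool * move) :=
  (shift a.2 x.1,
   if a.1 is Some b then fun n => if n == x.1 then Some b else x.2 n else x.2).

Lemma foldl_act2_loud x u : foldl act2 x [seq a <- u | loud2 a] = foldl act2 x u.
Proof.
have E y : act2 y (None, Stay) = y by case: y.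
by elim: u x => //= -[[b|] []] u IH x; rewrite /= /loud2 /= IH ?E.
Qed.

Lemma output2E M p t :
  output2 M p t = foldl act2 (0, fun=> None)
    [seq a <- trace M p t init_config | loud2 a].
Proof.
rewrite foldl_act2_loud -pmap_actionE; elim: t => // t IH.
rewrite -addn1 iotaD pmap_cat foldl_cat -IH addn1 /= add0n.
by case: (output2 M p t) => h o; case: action => [[[b|] m]|].
Qed.

(** A block of [stream_machine] only repeats a fixed action, so the choice of the symbol for cell 0
    becomes two counts, one of which is 0. The trip to cell z makes one more cell nonblank: the tape
    of [point v] is v followed by zeros. *)
Definition stage (v : bool) (z : nat) : seq (option bool * move) :=
  nseq v (Some true, Stay) ++ nseq (~~ v) (Some false, Stay) ++
  nseq z (None, Right) ++ [:: (Some false, Stay)] ++ nseq z (None, Left).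

(** Correct cells may be written again, since replacing a symbol by itself is no revision. *)
Fixpoint writes_only (v : bool) (h : nat) (u : seq (option bool * move)) : bool :=
  if u is a :: u' then
    (if a.1 is Some b then b == ((h == 0) && v) else true)
      && writes_only v (shift a.2 h) u'
  else true.

Lemma writes_only_cat v h u1 u2 : writes_only v h (u1 ++ u2) =
  writes_only v h u1 && writes_only v (foldl (fun h a => shift a.2 h) h u1) u2.
Proof. by elim: u1 h => //= a u IH h; rewrite IH andbA. Qed.

Lemma writes_only_moves v h z m : writes_only v h (nseq z (None, m)).
Proof. by elim: z h => /=. Qed.

Lemma head_right h z :
  foldl (fun h (a : option bool * move) => shift a.2 h) h (nseq z (None, Right)) = z + h.
Proof. by elim: z h => //= z IH h; rewrite IH addSnnS. Qed.

Lemma head_left z :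
  foldl (fun h (a : option bool * move) => shift a.2 h) z (nseq z (None, Left)) = 0.
Proof. by elim: z => //= z. Qed.

Lemma head_stage v z :
  foldl (fun h (a : option bool * move) => shift a.2 h) 0 (stage v z) = 0.
Proof.
by rewrite /stage !foldl_cat; case: v => /=; rewrite head_right addn0 head_left.
Qed.

Lemma writes_only_stage v z : 0 < z -> writes_only v 0 (stage v z).
Proof.
move=> z0; rewrite /stage; case: v => /=; rewrite writes_only_cat writes_only_moves /=;
by rewrite head_right addn0 writes_only_moves; case: z z0.
Qed.

Lemma foldl_act2_right z h o :
  foldl act2 (h, o) (nseq z (None, Right)) = (z + h, o).
Proof. by elim: z h => //= z IH h; rewrite IH addSnnS. Qed.

Lemma foldl_act2_left z o : foldl act2 (z, o) (nseq z (None, Left)) = (0, o).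
Proof. by elim: z => //= z. Qed.

Lemma foldl_act2_stage v z o : foldl act2 (0, o) (stage v z) =
  (0, fun n => if n == z then Some false else if n == 0 then Some v else o n).
Proof.
rewrite /stage !foldl_cat; case: v => /=; rewrite foldl_act2_right addn0 /=;
by rewrite /act2 /= foldl_act2_left.
Qed.

(* (n == 0) && v is the content of cell n of the tape of point v. *)
Definition shows (v : bool) (o : nat -> option bool) : Prop :=
  forall n b, o n = Some b -> b = ((n == 0) && v).

Lemma act2_shows v x a u : shows v x.2 -> writes_only v x.1 (a :: u) ->
  [/\ shows v (act2 x a).2, writes_only v (act2 x a).1 u &
      forall n b, x.2 n = Some b -> (act2 x a).2 n = Some b].
Proof.
move=> sx /= /andP[wa wu]; split=> //; case: a wa {wu} => [[c|] m] //= /eqP -> n b.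
  by case: eqP => [->|_]; [case|exact: sx].
by case: eqP => [->|_] // E; rewrite -(sx _ _ E).
Qed.

Lemma foldl_act2_shows v x u : shows v x.2 -> writes_only v x.1 u ->
  shows v (foldl act2 x u).2 /\
  forall n b, x.2 n = Some b -> (foldl act2 x u).2 n = Some b.
Proof.
elim: u x => // a u IH x sx wx; have [sy wy k] := act2_shows sx wx.
by have [sz k'] := IH _ sy wy; split=> // n b /k /k'.
Qed.

(** Undefined off Cantor space: with entries above 1 the tape would lose the layout on which [guess]
    relies. *)
Definition diag_realizer : pfun := fun p =>
  if `[< exists x, p = cantor_name x >] then Some (point (diag (fun n => p n != 0)))
  else None.

Lemma diag_realizer_name x : diag_realizer (cantor_name x) = Some (point (diag x)).
Proof.
rewrite /diag_realizer asboolT; last by exists x.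
by congr (Some (point (diag _))); apply: funext => n; rewrite /cantor_name; case: (x n).
Qed.

Lemma diag_realizer_Some p q : diag_realizer p = Some q ->
  exists2 x, p = cantor_name x & q = point (diag x).
Proof.
move=> E; have [x Ex] : exists x, p = cantor_name x.
  by move: E; rewrite /diag_realizer; case: asboolP.
by exists x => //; move: E; rewrite Ex diag_realizer_name => -[].
Qed.

Lemma deltaS_point v : deltaS (point v) = v.
Proof.
rewrite /deltaS; case: v; apply/negP => /=.
  by move/asboolP => /(_ 0).
by apply; apply/asboolP => n; rewrite /point andbF.
Qed.

Lemma diag_realizer_realizes : realizes diag_realizer diag.
Proof.
by move=> x; exists (point (diag x)); [exact: diag_realizer_name|exact: deltaS_point].
Qed.

Lemma foldl_act2_head x u :
  (foldl act2 x u).1 = foldl (fun h a => shift a.2 h) x.1 u.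
Proof. by elim: u x => //= a u IH x; rewrite IH. Qed.

Lemma cat_injr T (s t u : seq T) : s ++ t = s ++ u -> t = u.
Proof. by elim: s => //= x s IH [/IH]. Qed.

Section MindChange.
Variables (G : nat -> bool) (v : bool) (z0 : nat).
Hypothesis G_limit : forall z, z0 <= z -> G z = v.

Definition stages (z : nat) := flatten [seq stage (G k) k | k <- iota 1 z].

Lemma stages_cat z k : stages (z + k) =
  stages z ++ flatten [seq stage (G k) k | k <- iota z.+1 k].
Proof. by rewrite /stages iotaD map_cat flatten_cat. Qed.

Lemma foldl_act2_stages z : foldl act2 (0, fun=> None) (stages z) =
  (0, fun n => if n <= z then if n == 0 then if z == 0 then None else Some (G z)
                              else Some false else None).
Proof.
elim: z => [|z IH].
  by congr pair; apply: funext => -[].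
rewrite -addn1 stages_cat foldl_cat IH /= cats0 foldl_act2_stage addn1.
congr pair; apply: funext => -[|n] //=.
by rewrite ltnS eqSS; case: (ltngtP n z).
Qed.

Lemma shows_stages z : z0 <= z -> shows v (foldl act2 (0, fun=> None) (stages z)).2.
Proof.
move=> lez n b; rewrite foldl_act2_stages /=.
case: ifP => // _; case: n => [|n] /=; last by case.
by case: z lez => [|z] // le [<-]; rewrite G_limit.
Qed.

Lemma writes_only_stages z k : z0 <= z ->
  writes_only v 0 (flatten [seq stage (G k) k | k <- iota z.+1 k]).
Proof.
elim: k z => //= k IH z lez; rewrite writes_only_cat head_stage IH ?leqW //.
by rewrite G_limit ?leqW // writes_only_stage.
Qed.

Variables (M : machine2) (p : baire) (tau : nat -> nat).
Hypothesis tau_ge : forall z, z <= tau z.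
Hypothesis trace_tau : forall z,
  [seq a <- trace M p (tau z) init_config | loud2 a] = stages z.

(** The time t may fall inside a round. The trace up to t is a prefix of the one at the end of a
    later round, and [writes_only] passes to prefixes. *)
Lemma trace_after z t : z0 <= z -> tau z <= t ->
  exists2 u, [seq a <- trace M p t init_config | loud2 a] = stages z ++ u &
    writes_only v 0 u.
Proof.
move=> lez let_.
have tracecat t1 t2 : t1 <= t2 -> exists u,
    [seq a <- trace M p t2 init_config | loud2 a] =
    [seq a <- trace M p t1 init_config | loud2 a] ++ u.
  by move=> /subnKC <-; rewrite trace_add filter_cat; eexists.
have [u Eu] := tracecat _ _ let_; rewrite trace_tau in Eu.
have [u' Eu'] := tracecat _ _ (leq_trans (leq_maxl t z) (tau_ge (maxn t z))).
exists u => //; move: Eu'; rewrite trace_tau Eu -catA -(subnKC (leq_maxr t z)) stages_cat.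
move/cat_injr => Er.
by have := writes_only_stages (maxn t z - z) lez; rewrite Er writes_only_cat => /andP[].
Qed.

Lemma stages_limit_produces : limit_produces M p (point v).
Proof.
(* From round z0 on the guess is right; [n <= z] makes cell n nonblank, and [1 <= z] ensures that
   cell 0 has been written. *)
move=> n; pose z := maxn (maxn z0 1) n; exists (tau z) => t let_.
have lez : z0 <= z by rewrite /z; lia.
have [u Eu wu] := trace_after lez let_.
rewrite /output_cell output2E Eu foldl_cat tape_of_point.
have hz := foldl_act2_stages z.
have wx : writes_only v (foldl act2 (0, fun=> None) (stages z)).1 u by rewrite hz.
have [_ keep] := foldl_act2_shows (shows_stages lez) wx.
apply: keep; rewrite hz /= (_ : n <= z); last by rewrite /z; lia.
have -> : (z == 0) = false by apply/eqP; rewrite /z; lia.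
by rewrite G_limit //; case: n {z let_ lez Eu hz wx} => // n; rewrite nth_default.
Qed.

(** After round z0 every symbol written agrees with what the nonblank cells already show, so all
    revisions occur before [tau z0]. *)
Lemma stages_finitely_many_revisions : finitely_many_revisions M p.
Proof.
apply: (sub_finite_set (B := `I_(tau z0))); last exact: finite_II.
move=> t [n [b [E1 E2]]] /=; rewrite ltnNge; apply/negP => let_; apply: E2.
have [u Eu wu] := trace_after (leqnn z0) let_.
have [w Ew ww] := trace_after (leqnn z0) (leqW let_).
move: E1; rewrite /output_cell !output2E.
have Et : [seq a <- trace M p t.+1 init_config | loud2 a] =
  [seq a <- trace M p t init_config | loud2 a] ++
  [seq a <- trace M p 1 (iter t (step M p) init_config) | loud2 a].
  by rewrite -addn1 trace_add filter_cat.
move: ww; rewrite (_ : w = u ++ [seq a <- trace M p 1 (iter t (step M p) init_config)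
    | loud2 a]); last by apply: (@cat_injr _ (stages z0)); rewrite catA -Eu -Ew.
rewrite writes_only_cat => /andP[_ w1].
rewrite Et [in foldl _ _ (_ ++ _)]foldl_cat.
set x := foldl act2 _ [seq a <- trace M p t init_config | loud2 a].
have Ex : x = foldl act2 (foldl act2 (0, fun=> None) (stages z0)) u.
  by rewrite /x Eu foldl_cat.
have sx : shows v x.2.
  rewrite Ex; apply: (proj1 (foldl_act2_shows (shows_stages (leqnn z0)) _)).
  by rewrite foldl_act2_stages.
apply: (proj2 (foldl_act2_shows sx _)).
by rewrite Ex foldl_act2_head foldl_act2_stages.
Qed.

End MindChange.

Lemma diag_realizer_finite_mind_change : finite_mind_change_computable diag_realizer.
Proof.
have [c1 E1] : exists c, forall p z, ev c (bits_code p z) =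
    guess (mkseq (tape_of p) z).
  apply: (pr_of_PR (F := fun l => guess l)).
  by apply: PR_nat_of_bool; apply: PR_guess; exact: PR_id.
have [c2 E2] : exists c, forall p z, ev c (bits_code p z) =
    ~~ guess (mkseq (tape_of p) z).
  apply: (pr_of_PR (F := fun l => ~~ guess l)).
  by apply: PR_nat_of_bool; apply: PR_not; apply: PR_guess; exact: PR_id.
have [c3 E3] : exists c, forall p z, ev c (bits_code p z) = size (mkseq (tape_of p) z).
  by apply: (pr_of_PR (F := fun l => size l)); apply: PR_size; exact: PR_id.
have [c4 E4] : exists c, forall p z, ev c (bits_code p z) = 1.
  by apply: (pr_of_PR (F := fun=> 1)); exact: PR_const.
pose silent (a : option bool * move) := if a is (None, Stay) then true else false.
(* The five blocks spell out the five pieces of [stage]. *)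
pose blocks : seq (pr * (option bool * move)) :=
  [:: (c1, (Some true, Stay)); (c2, (Some false, Stay)); (c3, (None, Right));
      (c4, (Some false, Stay)); (c3, (None, Left))].
have [M MP] := @stream_machine _ silent (None, Stay) blocks isT isT.
exists M => p q /diag_realizer_Some[x Ep Eq].
have [tau tauP] := MP p; have [z0 z0P] := guess_limit x.
have trace_tau z : [seq a <- trace M p (tau z) init_config | loud2 a] =
    stages (fun k => guess (mkseq (tape x) k)) z.
  have [_ E] := tauP z; rewrite [LHS]E /stages; congr flatten; apply: eq_map => k.
  by rewrite /emission /= E1 E2 E3 E4 size_mkseq cats0 Ep.
have tau_ge z : z <= tau z by case: (tauP z).
rewrite Eq; split; first exact: (stages_limit_produces z0P tau_ge trace_tau).
exact: (stages_finitely_many_revisions z0P tau_ge trace_tau).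
Qed.

(** * Lowness *)

Section Baire.
Local Open Scope classical_set_scope.

Lemma baire_cvg (D : set_system baire) (q : baire) : Filter D ->
  (forall k, D [set p | p k = q k]) -> D --> q.
Proof.
move=> FD H; apply/cvg_sup => k; apply/cvg_image.
  rewrite eqEsubset; split=> // n _; by exists (fun=> n).
move=> U /nbhs_singleton Uq; exists ((fun p : baire => p k) @^-1` U).
  by apply: filterS (H k) => p /= ->.
by rewrite image_preimage // eqEsubset; split=> // n _; exists (fun=> n).
Qed.

Lemma nbhs_coord (q : baire) k : nbhs q [set p | p k = q k].
Proof.
have := @proj_continuous nat (fun=> nat) k q [set q k] (discrete_set1 _).
exact.
Qed.

Lemma nbhs_prefix (q : baire) n : nbhs q [set p | forall k, k < n -> p k = q k].
Proof.
elim: n => [|n IH]; first by apply: filterS filterT => p _ k.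
apply: filterS (filterI IH (nbhs_coord q n)) => p [H E] k.
by rewrite ltnS leq_eqVlt => /orP[/eqP ->|/H].
Qed.

Lemma is_limP r q :
  is_lim r q <-> forall k, exists N, forall n, N <= n -> r (pairn n k) = q k.
Proof.
split=> [H k|H]; last first.
  by apply: baire_cvg => k; have [N HN] := H k; exists N => // n /= /HN.
by have [N _ HN] := H _ (nbhs_coord q k); exists N => n /HN.
Qed.

End Baire.

Lemma is_lim_unique r q q' : is_lim r q -> is_lim r q' -> q = q'.
Proof.
move=> /is_limP H /is_limP H'; apply: funext => k.
have [N HN] := H k; have [N' HN'] := H' k.
by rewrite -(HN (maxn N N')) ?leq_maxl // HN' // leq_maxr.
Qed.

(** * Injectivity of the Turing jump *)

Lemma tape_of_inj : injective tape_of.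
Proof.
move=> q q' E; apply: funext => n; elim/ltn_ind: n => n IH.
have Eu : unary q n = unary q' n.
  by congr flatten; apply/eq_in_map => k; rewrite mem_iota => /IH ->.
case: (ltngtP (q n) (q' n)) => // lt.
  have := @tape_ofE q n (q n) (leqnn _); rewrite E Eu tape_ofE; last exact: ltnW.
  by rewrite lt ltnn.
have := @tape_ofE q' n (q' n) (leqnn _); rewrite -E -Eu tape_ofE; last exact: ltnW.
by rewrite lt ltnn.
Qed.

Section CellTest.
Variable h : nat.

(** Such machines make the tape of p readable from [jump p]. State s looks at cell s; in state h the
    machine loops on 0, and the missing entry for 1 makes it halt. *)
Definition cell_test_rule (k : nat * bool) : rule (option bool) :=
  if k.1 < h then Rule k.1 k.2 0 k.1.+1 0 Right Stay None
  else Rule k.1 k.2 0 k.1 0 Stay Stay None.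

Definition cell_test : machine1 :=
  map cell_test_rule [seq k <- [seq (s, b) | s <- iota 0 h.+1, b <- [:: true; false]]
                     | k != (h, true)].

Variable p : baire.
Let conf s := Config s s 0 (fun=> 0).

Lemma next_rule_cell_test s : s <= h ->
  next_rule cell_test p (conf s) =
  if (s, tape_of p s) == (h, true) then None else Some (cell_test_rule (s, tape_of p s)).
Proof.
move=> les; rewrite /next_rule /cell_test filter_map ohead_map -filter_predI.
have app k : applicable p (conf s) (cell_test_rule k) = (k == (s, tape_of p s)).
  by rewrite /applicable /cell_test_rule; case: k => u b; case: ifP => _;
    rewrite /= andbT xpair_eqE.
case: eqP => [E|ne].
  rewrite (_ : seq.filter _ _ = [::]) //; apply/eqP; rewrite -[_ == _]negbK -has_filter.
  by apply/hasP => -[k _ /=]; rewrite app => /andP[/eqP ->]; rewrite E eqxx.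
rewrite (@ohead_filter _ _ _ (s, tape_of p s)) //.
- apply/allpairsP; exists (s, tape_of p s); split=> //=.
    by rewrite -/(iota 0 h.+1) mem_iota.
  by case: tape_of.
- by rewrite /= app eqxx /=; apply/eqP.
by move=> k _ /=; rewrite app => /andP[/eqP].
Qed.

Lemma run_cell_test s : s <= h -> run cell_test p s = conf s.
Proof.
elim: s => // s IH lts; rewrite /run iterS -/(run _ p s) IH ?(ltnW lts) // /step.
rewrite next_rule_cell_test ?(ltnW lts) // xpair_eqE (ltn_eqF lts) /=.
by rewrite /cell_test_rule /= lts; congr Config; apply: funext => k; case: eqP.
Qed.

Lemma cell_testP : halts cell_test p <-> tape_of p h.
Proof.
have E := next_rule_cell_test (leqnn h); rewrite xpair_eqE eqxx /= in E.
split=> [[t]|ph]; last by exists h; rewrite run_cell_test // E ph.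
case ph: (tape_of p h) => //=; rewrite ph /= in E.
have H n : run cell_test p (h + n) = conf h.
  elim: n => [|n IH]; first by rewrite addn0 run_cell_test.
  rewrite addnS /run iterS -/(run _ p _) IH /step E /cell_test_rule /= ltnn.
  by congr Config; apply: funext => k; case: eqP.
case: (leqP h t) => [/subnKC <-|lt]; first by rewrite H E.
rewrite run_cell_test ?(ltnW lt) // next_rule_cell_test ?(ltnW lt) //.
by rewrite xpair_eqE (ltn_eqF lt).
Qed.

End CellTest.

Lemma jump_inj : injective jump.
Proof.
move=> q q' E; apply: tape_of_inj; apply: funext => h.
have [i Ei] := nth_machine_surj (cell_test h).
have := congr1 (fun r : baire => r i) E; rewrite /jump Ei.
case: asboolP => [/cell_testP qh|nq]; case: asboolP => [/cell_testP qh'|nq'] // _.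
  by rewrite qh qh'.
have -> : tape_of q h = false by apply/negbTE/negP => /cell_testP.
by apply/esym/negbTE/negP => /cell_testP.
Qed.

Definition low_name (p : baire) : baire := fun k => low_bit (mkseq (tape_of p) k.+1).

Lemma low_name_limit x : is_lim (low_name (cantor_name x)) (jump (point (diag x))).
Proof.
apply/is_limP => e; have [s0 s0P] := guess_limit x.
have [s1 s1P] := @shalts_limit e [:: diag x] (point (diag x))
  (fun h => esym (tape_of_point _ _)).
exists (maxn s0 s1) => s; rewrite geq_max => /andP[le0 le1].
rewrite /low_name /low_bit size_mkseq /= pairnK -(s1P s le1) -(s0P (pairn s e).+1) //.
(* The guess belongs to stage [(pairn s e).+1], which is at least s. *)
apply: (leq_trans le0); rewrite leqW // /pairn.
have : (s + e).*2 <= (s + e) * (s + e).+1.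
  by case: (s + e) => // m; rewrite -muln2 leq_mul.
by move=> /half_leq; rewrite doubleK; lia.
Qed.

Lemma output1E M p t : output1 M p t =
  pmap id [seq a <- trace M p t init_config | ~~ ~~ isSome a].
Proof.
rewrite -pmap_actionE /output1; elim: (iota 0 t) => //= s l ->.
by case: action => [[b|]|].
Qed.

(** The domain is that of [diag_realizer] because [low] is an equivalence: elsewhere a limit that
    happens to be a jump would define extra values. *)
Definition low_realizer : pfun := fun p => omap (fun=> low_name p) (diag_realizer p).

Lemma low_realizer_computable : computable low_realizer.
Proof.
have [c1 E1] : exists c, forall p z, ev c (bits_code p z) =
    low_bit (mkseq (tape_of p) z).
  apply: (pr_of_PR (F := fun l => low_bit l)).
  by apply: PR_nat_of_bool; apply: PR_low_bit; exact: PR_id.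
have [c2 E2] : exists c, forall p z, ev c (bits_code p z) = 1.
  by apply: (pr_of_PR (F := fun=> 1)); exact: PR_const.
have [M MP] := @stream_machine _ (fun a : option bool => ~~ isSome a) None
  [:: (c1, Some true); (c2, Some false)] isT isT.
exists M => p q Eq.
have -> : q = low_name p.
  by move: Eq; rewrite /low_realizer; case: (diag_realizer p) => //= _ [].
have [tau tauP] := MP p => n; exists (tau n.+1); rewrite output1E.
have [_ ->] := tauP n.+1.
suff -> : flatten [seq emission [:: (c1, Some true); (c2, Some false)] (bits_code p k)
    | k <- iota 1 n.+1] = map Some (unary (low_name p) n.+1).
  have -> (s : seq bool) : pmap id (map Some s) = s by elim: s => //= b s ->.
  rewrite tape_of_unary (onthE _ _) (nth_map false) //.
  exact: leq_trans (leq_size_unary _ _).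
rewrite /unary map_flatten -map_comp -[1]addn0 iotaDl -map_comp; congr flatten.
apply: eq_map => k /=.
by rewrite /emission /= E1 E2 cats0 map_cat map_nseq.
Qed.

Lemma diag_realizer_low : low diag_realizer.
Proof.
exists low_realizer; first exact: low_realizer_computable.
move=> p q; split=> [E|[r]].
  exists (low_name p); first by rewrite /low_realizer E.
  by have [x -> ->] := diag_realizer_Some E; exact: low_name_limit.
rewrite /low_realizer; case E: (diag_realizer p) => [q'|] //= [<-] lim.
have [x Ep Eq'] := diag_realizer_Some E; congr Some; apply: jump_inj; rewrite Ep in lim.
by apply: is_lim_unique lim; rewrite Eq'; exact: low_name_limit.
Qed.

Lemma diag_realizer_limit_computable : limit_computable diag_realizer.
Proof.
by have [M MP] := diag_realizer_finite_mind_change; exists M => p q /MP[].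
Qed.

(** * Continuity and diagonalization *)

Lemma emits_first_inj i j j' : emits_first i j -> emits_first i j' -> j = j'.
Proof.
move=> [e n] [e' n']; case: (ltngtP j j') => // lt; first by case: (n' _ lt).
by case: (n _ lt).
Qed.

Lemma first_true_eq (x y : nat -> bool) i :
  (forall k, k <= i -> y k = x k) -> first_true x i -> first_true y i.
Proof. by move=> E [xi nx]; split=> [|k lt]; rewrite E ?nx // ltnW. Qed.

(** If x has a second 1, the prefix through it decides the value. Otherwise at most one position of
    a second 1 would give 0, and a prefix of x that shows a 0 there excludes it. *)
Lemma diag_open (x : cantor_space) : diag x ->
  exists n, forall y : cantor_space, (forall k, k < n -> y k = x k) -> diag y.
Proof.
move=> /asboolP[i xi H].
have Ei (y : cantor_space) : (forall k, k <= i -> y k = x k) -> first_true y i.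
  by move=> E; exact: first_true_eq E xi.
case: (pselect (exists j, tail x i j)) => [/ex_first_true[j xj]|nx].
  exists (i.+1 + j.+1) => y E; apply/asboolP; exists i.
    by apply: Ei => k lek; apply: E; lia.
  move=> j' yj'; suff -> : j' = j by exact: H.
  apply: first_true_inj yj' _; apply: first_true_eq xj => k lek.
  by apply: E; lia.
have nt k : tail x i k = false by apply/negbTE/negP => xk; apply: nx; exists k.
case: (pselect (exists j, emits_first i j)) => [[j bj]|nb]; last first.
  exists i.+1 => y E; apply/asboolP; exists i; first exact: Ei.
  by move=> j' _ b; apply: nb; exists j'.
exists (i.+1 + j.+1) => y E; apply/asboolP; exists i.
  by apply: Ei => k lek; apply: E; lia.
move=> j' [yj' _] /(emits_first_inj bj) Ej; rewrite -{}Ej in yj'.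
by move: yj'; rewrite /tail E -/(tail x i j) ?nt // ltn_add2l.
Qed.

(* diag_realizer is discontinuous at 0^omega. The realizer below is continuous,
   since position n of its output depends on the first n symbols of x only. *)
Definition cylinder_name (p : baire) : baire := fun n =>
  `[< forall y : cantor_space, (forall k, k < n -> y k = (p k != 0)) -> diag y >].

Lemma cylinder_realizes : realizes (fun p => Some (cylinder_name p)) diag.
Proof.
move=> x; exists (cylinder_name (cantor_name x)) => //; rewrite /deltaS.
have Ex k : (cantor_name x k != 0) = x k by rewrite /cantor_name; case: (x k).
case fx: (diag x).
  apply/negP => /asboolP H; have [n Hn] := diag_open fx.
  have := H n; rewrite /cylinder_name asboolT // => y Hy; apply: Hn => k /Hy ->.
  exact: Ex.
apply/negbTE; rewrite negbK; apply/asboolP => n; rewrite /cylinder_name asboolF // => H.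
by have := H x (fun k _ => esym (Ex k)); rewrite fx.
Qed.

Lemma cylinder_continuous : pcontinuous (fun p => Some (cylinder_name p)).
Proof.
apply: continuous_subspaceT => p.
apply: baire_cvg => n; apply: filterS (nbhs_prefix p n) => p' Hp.
congr nat_of_bool; apply: asbool_equiv_eq; split=> H y Hy; apply: H => k ltk.
  by rewrite Hy // Hp.
by rewrite Hy // Hp.
Qed.

(** * Finite use of the input and the diagonal argument *)

Lemma run_eq A (M : machine A) p p' t :
  (forall h, h < t -> tape_of p h = tape_of p' h) -> run M p t = run M p' t.
Proof.
elim: t => // t IH E; rewrite /run !iterS -/(run M p t) -/(run M p' t).
rewrite IH; last by move=> h /ltnW; exact: E.
rewrite /step /next_rule /applicable E //.
by rewrite ltnS input_head_run.
Qed.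

Lemma action_eq A (M : machine A) p p' t :
  (forall h, h <= t -> tape_of p h = tape_of p' h) -> action M p t = action M p' t.
Proof.
move=> E; rewrite /action (run_eq M (p' := p')); last by move=> h /ltnW; exact: E.
by rewrite /next_rule /applicable E // input_head_run.
Qed.

Lemma output1_true M p n t : onth (output1 M p t) n = Some true ->
  exists s, action M p s = Some (Some true).
Proof.
rewrite /output1; elim: (iota 0 t) n => [|s l IH] n /=; first by rewrite onth0n.
case E: (action M p s) => [[[]|]|] /=; try by [exists s | apply: IH].
by case: n => [|n] //=; exact: IH.
Qed.

(** Symbols are only appended, so a symbol once output keeps its position and must agree with the
    tape of [q]. *)
Lemma produces_action M p q s b : produces M p q -> action M p s = Some (Some b) ->
  exists n, tape_of q n = b.
Proof.
move=> Mq E; have Eo u k : output1 M p (u + k) = output1 M p u ++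
    pmap (fun s => obind id (action M p s)) (iota u k).
  by rewrite /output1 iotaD pmap_cat.
pose n := size (output1 M p s); exists n; have [t Et] := Mq n.
have En : onth (output1 M p s.+1) n = Some b.
  by rewrite -addn1 Eo /= E /= onth_cat ltnn subnn.
have keep u k : onth (output1 M p u) n != None ->
    onth (output1 M p (u + k)) n = onth (output1 M p u) n.
  by rewrite Eo onth_cat -onthTE; case: (onth _ n).
have := keep t s.+1; rewrite Et => /(_ isT) E1.
by have := keep s.+1 t; rewrite En => /(_ isT); rewrite addnC E1 => -[].
Qed.

Lemma diag_not_relative : ~ has_realizer (computable_relative_to halting_problem) diag.
Proof.
move=> [F2 F2f [G [M MG] F2G]]; have [i Ei] := nth_machine_surj M.
have Mprod (x : cantor_space) : exists2 q, deltaS q = diag x &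
    produces M (interleave halting_problem (cantor_name x)) q.
  by have [q /F2G/MG Mq qx] := F2f x; exists q.
(* [oracle_input i] is convertible to [interleave halting_problem (cantor_name x)]: machine i runs
   on the point that names it. *)
pose x : cantor_space := fun k => k == i.
have xi : first_true x i by split=> [|k lt]; rewrite /x ?eqxx // ltn_eqF.
have tx k : tail x i k = false by apply/negbTE; rewrite /tail /x; lia.
have [j bj] : exists j, emits_first i j.
  have [q qx Mq] := Mprod x.
  have fx : diag x by apply/asboolP; exists i => // j [xj _]; rewrite tx in xj.
  have [n qn] : exists n, q n != 0.
    apply: contrapT => nq; move: qx; rewrite fx /deltaS => /negP; apply.
    by apply/asboolP => n; apply/eqP; apply: contrapT => /negP qn; apply: nq; exists n.
  have [h qh] := ex_tape_of qn; have [t] := Mq h; rewrite qh => /output1_true.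
  move=> [s Es].
  have ex : exists s, `[< action (nth_machine i) (oracle_input i) s = Some (Some true) >].
    by exists s; apply/asboolP; rewrite Ei.
  exists (ex_minn ex); case: ex_minnP => s' /asboolP e min; split=> // u lt /asboolP /min.
  by rewrite leqNgt lt.
(* The second 1 sits at the exceptional distance j, which makes the value 0, yet machine i still
   outputs a 1 in step j. *)
pose y : cantor_space := fun k => (k == i) || (k == i.+1 + j).
have yi : first_true y i.
  split=> [|k lt]; rewrite /y ?eqxx // ltn_eqF //=; lia.
have yj : first_true (tail y i) j.
  split=> [|k lt]; rewrite /tail /y; lia.
have fy : diag y = false.
  apply/asboolP => -[i' yi' H]; rewrite -(first_true_inj yi yi') in H.
  exact: H yj bj.
have [q qy Mq] := Mprod y; rewrite fy in qy.
have [n qn] : exists n, tape_of q n = true.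
  apply: (produces_action (s := j) Mq); rewrite -(proj1 bj) -Ei; apply: action_eq => h leh.
  apply: eq_tape_of => k lek; rewrite /oracle_input /interleave; case: ifP => // _.
  rewrite /cantor_name /single /y; congr nat_of_bool.
  have -> : (k./2 == i.+1 + j) = false; last by rewrite orbF.
  (* A cell h <= j involves only entries k <= j, whereas the second 1 is entry 2(i + 1 + j) + 1 of
     the interleaved input. *)
  apply/eqP => E; have := leq_half_double k k; have := leq_half_double k k; lia.
have [k _] := tape_of_neq0 qn; move: qy; rewrite /deltaS => /negbT; rewrite negbK.
by move=> /asboolP ->.
Qed.

Theorem proposition6p11 :
  exists f : cantor_space -> sierpinski,
    [/\ has_realizer pcontinuous f,
        has_realizer finite_mind_change_computable f,
        has_realizer low f,
        has_realizer limit_computable f &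
        ~ has_realizer (computable_relative_to halting_problem) f].
Proof.
exists diag; split.
- exists (fun p => Some (cylinder_name p));
    [exact: cylinder_realizes|exact: cylinder_continuous].
- by exists diag_realizer;
    [exact: diag_realizer_realizes|exact: diag_realizer_finite_mind_change].
- by exists diag_realizer; [exact: diag_realizer_realizes|exact: diag_realizer_low].
- by exists diag_realizer;
    [exact: diag_realizer_realizes|exact: diag_realizer_limit_computable].
exact: diag_not_relative.
Qed.
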